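(* Let $N\ne0$ and let $\theta$ be fixed with $\varepsilon\le|\theta|\le\pi-\varepsilon$. Then $|\phi(s)z^{-s}|\to0$ super-exponentially along $\arg s=\theta$ if and only if $N\cos2\theta<0$. Consequently - if $N>0$ the decay sectors are the two vertical ones, $|\theta\mp\frac{\pi}{2}|<\frac{\pi}{4}$; - if $N<0$ the decay sectors are the two horizontal ones, $|\theta|<\frac{\pi}{4}$ and $|\theta-\pi|<\frac{\pi}{4}$.
   Context: For $\tau>0$, $G(z;\tau)$ is the Barnes double gamma function: the entire function $G(z;\tau)=\frac{z}{\tau}e^{c_1 z/\tau+c_2 z^2/(2\tau^2)}\prod_{(k,l)\in\mathbb{Z}_{\ge0}^2\setminus\{(0,0)\}}\big(1+\frac{z}{k\tau+l}\big)e^{-\frac{z}{k\tau+l}+\frac{z^2}{2(k\tau+l)^2}}$, with real constants $c_1,c_2$ (depending on $\tau$) uniquely determined by $G(z+1;\tau)=\Gamma(z/\tau)G(z;\tau)$ and $G(z+\tau;\tau)=(2\pi)^{(\tau-1)/2}\tau^{1/2-z}\Gamma(z)G(z;\tau)$. Let $\tau>0$, $0\le m\le q$, $0\le n\le p$ integers, $\mathbf a\in\mathbb{C}^p$, $\mathbf b\in\mathbb{C}^q$, $\alpha\in\mathbb{C}$, $$\phi(s)=\frac{\prod_{j=1}^{m}G(b_j-s;\tau)\prod_{j=1}^{n}G(1+\tau-a_j+s;\tau)}{\prod_{j=m+1}^{q}G(1+\tau-b_j+s;\tau)\prod_{j=n+1}^{p}G(a_j-s;\tau)}\,e^{\pi\alpha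 s^2/\tau},\qquad N=2(m+n)-p-q.$$ Here $\varepsilon\in(0,\pi)$ is fixed, $s=re^{i\theta}$ with $r=|s|\to\infty$, $z$ is a point of the Riemann surface of the logarithm and $z^{-s}=e^{-s\log z}$. The decay sectors are the sectors in which $\phi(s)z^{-s}$ decays super-exponentially.
   Formalization: ''Super-exponentially'' is read as faster than every e^{-C|s|^2} (faster than every e^{-C|s|} is treated only for cos 2θ≠0, since it fails on cos 2θ=0 for suitable α); the decay sectors are described ray by ray, within ε≤|θ|≤π-ε. *)

(* Defs.v *)
From HB Require Import structures.
From mathcomp Require Import all_boot all_order all_algebra.
From mathcomp Require Import all_classical all_reals all_analysis.
From mathcomp Require Import complex.

Set Implicit Arguments.
Unset Strict Implicit.
Unset Printing Implicit Defensive.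

Import Order.TTheory GRing.Theory Num.Theory numFieldNormedType.Exports.

Local Open Scope classical_set_scope.
Local Open Scope ring_scope.
Local Open Scope complex_scope.

Section ComplexFunctions.
Variable R : realType.
Implicit Types (s z : R[i]) (r t : R).

Definition cis t : R[i] := cos t +i* sin t.

Definition Cexp z : R[i] := (expR (complex.Re z))%:C * cis (complex.Im z).

(* [t] to the complex power [z], for [t > 0]; elsewhere meaningless because of
   the convention [ln t = 0] for [t <= 0]. *)
Definition rpowC t z : R[i] := Cexp (z * (ln t)%:C).

(* Euler's limit formula for the Gamma function. *)
Definition Gamma z : R[i] :=
  lim ((fun n : nat =>
          (n`!)%:R * rpowC n%:R z / \prod_(0 <= k < n.+1) (z + k%:R) : R[i]^o)
       @ \oo).

Definition nonpos_integer z := exists k : nat, z = - k%:R.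

End ComplexFunctions.

Section BarnesDoubleGamma.
Variables (R : realType) (tau : R).
Implicit Types (z : R[i]) (c : R * R).

Definition lattice_pt (k l : nat) : R[i] := (k%:R * tau + l%:R)%:C.

Definition barnes_factor z (k l : nat) : R[i] :=
  let w := lattice_pt k l in
  (1 + z / w) * Cexp (- (z / w) + z ^+ 2 / (2 * w ^+ 2)).

(* The double product converges absolutely, so exhausting the index set
   by squares gives its value. *)
Definition barnes_prod z : R[i] :=
  lim ((fun M : nat => \prod_(0 <= k < M) \prod_(0 <= l < M | (k, l) != (0, 0)%N)
                         barnes_factor z k l : R[i]^o) @ \oo).

Definition barnes_weierstrass c z : R[i] :=
  z / tau%:C
  * Cexp ((c.1)%:C * z / tau%:C + (c.2)%:C * z ^+ 2 / (2 * (tau ^+ 2)%:C))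
  * barnes_prod z.

(* The two functional equations, away from the poles of their Gamma factor
   (where the right-hand side would read infinity times zero). *)
Definition barnes_shift (G : R[i] -> R[i]) : Prop :=
  (forall z, ~ nonpos_integer (z / tau%:C) ->
     G (z + 1) = Gamma (z / tau%:C) * G z) /\
  (forall z, ~ nonpos_integer z ->
     G (z + tau%:C) =
       ((2 * pi) `^ ((tau - 1) / 2))%:C * rpowC tau (2^-1 - z) * Gamma z * G z).

(* The pair (c_1, c_2) is the unique one satisfying the functional equations. *)
Definition barnes_consts : R * R :=
  get [set c | barnes_shift (barnes_weierstrass c)].

Definition barnesG z : R[i] := barnes_weierstrass barnes_consts z.

End BarnesDoubleGamma.

Section Phi.
Variables (R : realType) (tau : R) (p q m n : nat).
Variables (a : 'rV[R[i]]_p) (b : 'rV[R[i]]_q) (alpha : R[i]).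

(* Indices start at 0: the paper's j = 1, ..., m are the [j < m] here. *)
Definition phi (s : R[i]) : R[i] :=
  let G := barnesG tau in
  ((\prod_(j < q | (j < m)%N) G (b 0 j - s))
   * (\prod_(j < p | (j < n)%N) G (1 + tau%:C - a 0 j + s)))
  / ((\prod_(j < q | (m <= j)%N) G (1 + tau%:C - b 0 j + s))
     * (\prod_(j < p | (n <= j)%N) G (a 0 j - s)))
  * Cexp (pi%:C * alpha * s ^+ 2 / tau%:C).

End Phi.

Definition exponentN (p q m n : nat) : int :=
  2 * (m%:Z + n%:Z) - p%:Z - q%:Z.

(* A point of the Riemann surface of the logarithm; [log_arg] is any real
   number, not reduced modulo 2 pi. *)
Record log_surface (R : realType) := LogSurface {
  log_mod : R;
  log_arg : R;
  log_mod_gt0 : 0 < log_mod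
}.

Definition log_surface_log (R : realType) (z : log_surface R) : R[i] :=
  ln (log_mod z) +i* log_arg z.

(* z^{-s} *)
Definition log_surface_powN (R : realType) (z : log_surface R) (s : R[i]) : R[i] :=
  Cexp (- s * log_surface_log z).

Section Decay.
Variable R : realType.
Implicit Types (f : R[i] -> R[i]) (theta eps c : R).

(* Along the ray [arg s = theta], [f] tends to 0 faster than every
   [exp (- C * |s| ^ k)]. *)
Definition decays_beyond_exp (k : nat) f theta : Prop :=
  forall C : R,
    Normc.normc (f (r%:C * cis theta)) * expR (C * r ^+ k) @[r --> +oo] --> (0 : R).

(* The functions considered carry an arbitrary factor [exp (pi * alpha * s ^ 2 / tau)],
   so "exponential" refers to the scale [exp (O (|s| ^ 2))]: decay is
   super-exponential when it is faster than every [exp (- C * |s| ^ 2)].  With the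
   weaker requirement "faster than every [exp (- C * |s|)]", a suitable [alpha] would
   produce decay along rays with [cos (2 * theta) = 0]. *)
Definition superexp_decay f theta : Prop := decays_beyond_exp 2 f theta.

Definition admissible eps : set R :=
  [set theta | eps <= `|theta| <= pi - eps].

Definition decay_directions eps f : set R :=
  [set theta | admissible eps theta /\ superexp_decay f theta].

(* The directions in the open sector of half-opening pi/4 around direction [c];
   angles are compared modulo 2 pi. *)
Definition sector c : set R :=
  [set theta | exists k : int, `|theta - c - 2 * pi * k%:~R| < pi / 4].

End Decay.

(* Main.v *)
Require Import Defs.
From HB Require Import structures.
From mathcomp Require Import all_boot all_order all_algebra.
From mathcomp Require Import all_classical all_reals all_analysis.
From mathcomp Require Import complex ring lra.
Import Order.TTheory GRing.Theory Num.Theory numFieldNormedType.Exports.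
Local Open Scope classical_set_scope.
Local Open Scope ring_scope.

Set Implicit Arguments.
Unset Strict Implicit.

(** The proof is Stirling's formula for [G] to leading order: along a ray
    [z = c + r d] with [|d| = 1] and [Im d <> 0],
      [ln |G(z; tau)| = Re(d ^ 2) / (2 tau) * r ^ 2 ln r + O(r ^ 2)]
    ([log_growth_barnesG_ray]).  With [d = cis theta] or [d = - cis theta] one has
    [Re(d ^ 2) = cos(2 theta)], so each of the [p + q] factors of [phi]
    contributes the same main term, with the sign given by its place in the
    quotient.  The signs add up to [N], while the Gaussian factor and [z^{-s}] are
    [exp(O(r ^ 2))].  Hence (lemma [log_growth_phi])
      [ln |phi(s) z^{-s}| = N cos(2 theta) / (2 tau) * r ^ 2 ln r + O(r ^ 2)],
    and the sign of [N cos(2 theta)] decides everything.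

    For the asymptotics of [G] only the product formula is needed: the constants
    [c_1] and [c_2] are real numbers whose values affect the error term alone.  Let
    [E(x) = (1 + x) exp(- x + x ^ 2 / 2)], so that the factors of the product are
    the [E(z / w)] with [w = k tau + l].  Take a square [k, l < K] whose side [K] is
    a suitable constant times [|z|], and group the pairs [(k, l)] by
    [j = max(k, l)]; there are at most [3 j] of them on each shell and
    [w >= min(tau, 1) j].
    - Outside the square, [ln |E(x)| = O(|x| ^ 3)] ([ln_elem_factor_bound]) bounds
      the sum of the [ln |E(z / w)|] by [O(|z| ^ 3 / K) = O(|z| ^ 2)].
    - Inside, [ln |1 + z / w| - Re(z / w) = O(K / j)], because [z] stays away from
      the negative real axis; this sums to [O(K ^ 2) = O(|z| ^ 2)] and leaves
      [Re(z ^ 2) / 2] times the sum of the [w ^- 2].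
    - That last sum is [ln K / tau + O(1)] ([sqsum_inv_sq]), by comparing every
      shell with an integral.
    These bounds hold uniformly for the square partial products, whose successive
    quotients are [1 + O(j ^- 2)]; the products therefore converge and the bounds
    pass to the limit ([log_barnes_prod]). *)

(** * Moduli and sequences of complex numbers *)

Section ComplexModulus.
Variable R : realType.
Implicit Types (x y z : R[i]) (r t : R).

Lemma normc_sqr z :
  Normc.normc z ^+ 2 = complex.Re z ^+ 2 + complex.Im z ^+ 2.
Proof. by case: z => u v /=; rewrite sqr_sqrtr // addr_ge0 ?sqr_ge0. Qed.

Lemma normc_ge0 z : 0 <= Normc.normc z.
Proof. by case: z => u v; exact: sqrtr_ge0. Qed.

Lemma normc_ler z r : 0 <= r ->
  complex.Re z ^+ 2 + complex.Im z ^+ 2 <= r ^+ 2 -> Normc.normc z <= r.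
Proof.
by move=> r0 h; rewrite -(@ler_pXn2r _ 2) ?nnegrE ?normc_ge0 // normc_sqr.
Qed.

Lemma normc_triangle x y : Normc.normc (x + y) <= Normc.normc x + Normc.normc y.
Proof. exact: le_normcD. Qed.

Lemma normc_opp z : Normc.normc (- z) = Normc.normc z.
Proof. by case: z => u v /=; rewrite !sqrrN. Qed.

Lemma normc_triangleB x y :
  Normc.normc x - Normc.normc y <= Normc.normc (x + y).
Proof.
rewrite lerBlDr; apply: le_trans (_ : Normc.normc (x + y + - y) <= _).
  by rewrite addrK.
by rewrite -(normc_opp y); exact: normc_triangle.
Qed.

Lemma normc_real r : Normc.normc r%:C%C = `|r|.
Proof. by rewrite /= expr0n addr0 sqrtr_sqr. Qed.

Lemma normcX z k : Normc.normc (z ^+ k) = Normc.normc z ^+ k.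
Proof.
elim: k => [|k IH]; first exact: Normc.normc1.
by rewrite !exprS Normc.normcM IH.
Qed.

Lemma normc_prod (I : Type) (s : seq I) (P : pred I) (F : I -> R[i]) :
  Normc.normc (\prod_(i <- s | P i) F i)
  = \prod_(i <- s | P i) Normc.normc (F i).
Proof. by apply: big_morph; [exact: Normc.normcM|exact: Normc.normc1]. Qed.

Lemma le_Re_normc z : `|complex.Re z| <= Normc.normc z.
Proof.
rewrite -(@ler_pXn2r _ 2) ?nnegrE ?normc_ge0 // normc_sqr real_normK ?num_real //.
by rewrite lerDl sqr_ge0.
Qed.

Lemma le_Im_normc z : `|complex.Im z| <= Normc.normc z.
Proof.
rewrite -(@ler_pXn2r _ 2) ?nnegrE ?normc_ge0 // normc_sqr real_normK ?num_real //.
by rewrite lerDr sqr_ge0.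
Qed.

Lemma normc_le_ReIm z :
  Normc.normc z <= `|complex.Re z| + `|complex.Im z|.
Proof.
apply: normc_ler; first by rewrite addr_ge0.
rewrite sqrrD !real_normK ?num_real // -addrA [X in _ <= _ + X]addrC addrA lerDl.
by rewrite mulrn_wge0 // mulr_ge0.
Qed.

Lemma ReM x y : complex.Re (x * y) =
  complex.Re x * complex.Re y - complex.Im x * complex.Im y.
Proof. by case: x y => [a b] [c d]. Qed.

Lemma ImM x y : complex.Im (x * y) =
  complex.Re x * complex.Im y + complex.Im x * complex.Re y.
Proof. by case: x y => [a b] [c d]. Qed.

Lemma ReD x y : complex.Re (x + y) = complex.Re x + complex.Re y.
Proof. by case: x y => [a b] [c d]. Qed.

Lemma ImD x y : complex.Im (x + y) = complex.Im x + complex.Im y.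
Proof. by case: x y => [a b] [c d]. Qed.

Lemma ReN x : complex.Re (- x) = - complex.Re x.
Proof. by case: x. Qed.

Lemma ImN x : complex.Im (- x) = - complex.Im x.
Proof. by case: x. Qed.

Lemma ReZ r z : complex.Re (r%:C%C * z) = r * complex.Re z.
Proof. by rewrite ReM /= mul0r subr0. Qed.

Lemma ImZ r z : complex.Im (r%:C%C * z) = r * complex.Im z.
Proof. by rewrite ImM /= mul0r addr0. Qed.

Lemma div_realC z r : z / r%:C%C = (r^-1)%:C%C * z.
Proof. by rewrite fmorphV mulrC. Qed.

Lemma normc_Cexp z : Normc.normc (Cexp z) = expR (complex.Re z).
Proof.
rewrite /Cexp Normc.normcM normc_real ger0_norm ?expR_ge0 //.
by rewrite /cis /= cos2Dsin2 sqrtr1 mulr1.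
Qed.

Lemma normc_cis t : Normc.normc (cis t) = 1.
Proof. by rewrite /cis /= cos2Dsin2 sqrtr1. Qed.

End ComplexModulus.

Section ComplexSequences.
Variable R : realType.

(** Convergence in modulus is convergence for the topology of [R[i]]. *)
Lemma lim_normc (u : nat -> R[i]) (l : R[i]) :
  (fun k => Normc.normc (u k - l)) @ \oo --> (0 : R) ->
  lim ((u : nat -> R[i]^o) @ \oo) = l.
Proof.
move=> /cvgrPdist_lt h; apply: cvg_lim; first exact: norm_hausdorff.
apply/cvgrPdist_lt => e; rewrite ltcE /= => /andP[/eqP e_im e_re].
have := h _ e_re; apply: filterS => k.
rewrite sub0r normrN ger0_norm ?normc_ge0 // => hk.
have -> : e = (complex.Re e)%:C%C by case: e e_im {e_re hk} => a b /= ->.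
rewrite distrC normc_def ltcR; move: hk.
by case: (u k - l).
Qed.

(** A real sequence with increments [O(1/k^2)] converges: adding the telescoping
    correction [- 2 c / k] makes it nondecreasing. *)
Lemma cvg_of_increments (u : nat -> R) (c A : R) (K : nat) :
  (0 < K)%N -> 0 <= c ->
  (forall k, (K <= k)%N -> `|u k| <= A) ->
  (forall k, (K <= k)%N -> `|u k.+1 - u k| <= c / k%:R ^+ 2) ->
  exists l : R, u @ \oo --> l.
Proof.
move=> K0 c0 uA uinc.
pose e k : R := 2 * c / (k + K)%:R.
pose v k := u (k + K)%N - e k.
have kK k : 0 < (k + K)%:R :> R by rewrite ltr0n addn_gt0 K0 orbT.
have kK1 k : 1 <= (k + K)%:R :> R by rewrite ler1n addn_gt0 K0 orbT.
have v_inc : {homo v : k l / (k <= l)%N >-> k <= l}.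
  apply/nondecreasing_seqP => k; rewrite /v /e.
  have h := uinc (k + K)%N (leq_addl _ _).
  move: (h); rewrite ler_norml -addSn => /andP[h1 _].
  have h2 : 2 * c / (k.+1 + K)%:R <= 2 * c / (k + K)%:R - c / (k + K)%:R ^+ 2.
    rewrite addSn -[(k + K).+1%:R]natr1; move: (kK k) (kK1 k); set t : R := (k + K)%:R => t0 t1; clearbody t.
    rewrite -subr_ge0.
    have -> : 2 * c / t - c / t ^+ 2 - 2 * c / (t + 1)
              = c * (t - 1) / (t ^+ 2 * (t + 1)).
      by field; rewrite !gt_eqF ?addr_gt0.
    have t0' := ltW t0.
    by rewrite divr_ge0 ?mulr_ge0 ?subr_ge0 ?exprn_ge0 ?addr_ge0.
  lra.
have v_ub : has_ubound (range v).
  exists A => _ [k _ <-]; rewrite /v.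
  have h1 := uA (k + K)%N (leq_addl _ _).
  have h2 : 0 <= e k by rewrite /e divr_ge0 ?mulr_ge0 // ltW.
  by move: h1; rewrite ler_norml => /andP[_ h3]; lra.
have [l vl] : exists l : R, v @ \oo --> l.
  by exists (lim (v @ \oo)); exact: nondecreasing_is_cvgn.
exists l; rewrite -(cvg_shiftn K).
have -> : [sequence u (k + K)%N]_k = (fun k => v k + e k).
  by apply/funext => k; rewrite /v /= subrK.
rewrite -[l]addr0; apply: cvgD => //.
have -> : e = (fun k => (2 * c) * (k + K)%:R^-1) by [].
rewrite -[0](mulr0 (2 * c)); apply: cvgMr.
rewrite (cvg_shiftn K (fun k => k%:R^-1 : R)).
by rewrite -cvg_shiftS; exact: cvg_harmonic.
Qed.

Lemma cvg_normc_of_increments (u : nat -> R[i]) (c A : R) (K : nat) :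
  (0 < K)%N -> 0 <= c ->
  (forall k, (K <= k)%N -> Normc.normc (u k) <= A) ->
  (forall k, (K <= k)%N -> Normc.normc (u k.+1 - u k) <= c / k%:R ^+ 2) ->
  exists l : R[i], (fun k => Normc.normc (u k - l)) @ \oo --> (0 : R).
Proof.
move=> K0 c0 uA uinc.
have [a ha] : exists a : R, (fun k => complex.Re (u k)) @ \oo --> a.
  apply: (@cvg_of_increments _ c A K) => // k kK.
    exact: le_trans (le_Re_normc _) (uA k kK).
  by rewrite -ReN -ReD; exact: le_trans (le_Re_normc _) (uinc k kK).
have [b hb] : exists b : R, (fun k => complex.Im (u k)) @ \oo --> b.
  apply: (@cvg_of_increments _ c A K) => // k kK.
    exact: le_trans (le_Im_normc _) (uA k kK).
  by rewrite -ImN -ImD; exact: le_trans (le_Im_normc _) (uinc k kK).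
exists (Complex a b).
apply: (@squeeze_cvgr _ _ _ _ (fun=> 0)
  (fun k => `|complex.Re (u k) - a| + `|complex.Im (u k) - b|)).
- near=> k; rewrite normc_ge0 /=.
  by apply: le_trans (normc_le_ReIm _) _; rewrite ReD ImD ReN ImN.
- exact: cvg_cst.
- rewrite -[0]addr0; apply: cvgD.
    by apply/norm_cvg0P; rewrite -(subrr a); apply: cvgB => //; exact: cvg_cst.
  by apply/norm_cvg0P; rewrite -(subrr b); apply: cvgB => //; exact: cvg_cst.
Unshelve. all: by end_near.
Qed.

End ComplexSequences.

(** * The elementary factor of genus 2 *)

Section ElementaryFactor.
Variable R : realType.
Implicit Types (x : R[i]) (t : R).

(** The Weierstrass elementary factor of genus 2. *)
Definition elem_factor x : R[i] := (1 + x) * Cexp (- x + x ^+ 2 / 2).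

Lemma is_derive_quadratic (a b c t : R) :
  is_derive t 1 (fun y : R => a + b * y + c * y ^+ 2) (b + 2 * c * t).
Proof.
have -> : (fun y : R => a + b * y + c * y ^+ 2)
          = (cst a + b \*: (@id R) + c \*: ((@id R) ^+ 2)) :> (R -> R).
  by apply/funext.
apply: is_derive_eq.
by rewrite /= add0r /GRing.scale /=; ring.
Qed.

(** [g] is the [p]-[q] combination of the real and imaginary parts of
    [elem_factor (y x)], with [x = u + i v]; its derivative at [t] is the
    same combination for [(t x) ^ 2 x exp (- t x + (t x) ^ 2 / 2)].  The constant and
    quadratic coefficients equal to 0 make every inner function an instance of
    [is_derive_quadratic]. *)
Lemma is_derive_elem_factor (u v p q t : R) :
  let A := fun y : R => 0 + - u * y + (u ^+ 2 - v ^+ 2) / 2 * y ^+ 2 in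
  let B := fun y : R => 0 + - v * y + (u * v) * y ^+ 2 in
  let g := fun y : R => expR (A y) *
     ((p + (p * u + q * v) * y + 0 * y ^+ 2) * cos (B y)
      + (q + (q * u - p * v) * y + 0 * y ^+ 2) * sin (B y)) in
  let a3 := u ^+ 3 - 3 * u * v ^+ 2 in
  let b3 := 3 * u ^+ 2 * v - v ^+ 3 in
  is_derive t 1 g (expR (A t) * t ^+ 2 *
    ((p * a3 + q * b3) * cos (B t) + (q * a3 - p * b3) * sin (B t))).
Proof.
move=> A B g a3 b3.
have dA : is_derive t 1 A (- u + 2 * ((u ^+ 2 - v ^+ 2) / 2) * t).
  exact: is_derive_quadratic.
have dB : is_derive t 1 B (- v + 2 * (u * v) * t).
  exact: is_derive_quadratic.
pose P := fun y : R => p + (p * u + q * v) * y + 0 * y ^+ 2.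
pose Q := fun y : R => q + (q * u - p * v) * y + 0 * y ^+ 2.
have dP : is_derive t 1 P (p * u + q * v + 2 * 0 * t).
  exact: is_derive_quadratic.
have dQ : is_derive t 1 Q (q * u - p * v + 2 * 0 * t).
  exact: is_derive_quadratic.
have dE : is_derive t 1 (expR \o A)
    (expR (A t) * (- u + 2 * ((u ^+ 2 - v ^+ 2) / 2) * t)).
  exact: (@is_derive1_comp R _ _ t).
have dC : is_derive t 1 (cos \o B) (- sin (B t) * (- v + 2 * (u * v) * t)).
  exact: (@is_derive1_comp R _ _ t).
have dS : is_derive t 1 (sin \o B) (cos (B t) * (- v + 2 * (u * v) * t)).
  exact: (@is_derive1_comp R _ _ t).
have -> : g = (expR \o A) * (P * (cos \o B) + Q * (sin \o B)) by apply/funext.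
apply: is_derive_eq.
by rewrite /= /a3 /b3 /P /Q /GRing.scale /= !fctE /=; field.
Qed.

(** The mean value theorem along the segment from 0 to [x], where the derivative of
    [elem_factor] is [y ^ 2 exp (- y + y ^ 2 / 2)], applied to the real and to the
    imaginary part. *)
Lemma elem_factor_bound x : Normc.normc x <= 1 / 4 ->
  Normc.normc (elem_factor x - 1) <= 4 * Normc.normc x ^+ 3.
Proof.
move=> x4.
have n0 := normc_ge0 x.
case: x x4 n0 => u v x4 n0; set x := Complex u v in x4 n0 *.
have hu : `|u| <= 1 / 4 by apply: le_trans x4; exact: (le_Re_normc x).
have hx2 : u ^+ 2 + v ^+ 2 = Normc.normc x ^+ 2 by rewrite normc_sqr.
have key p q : (p, q) = (1, 0) \/ (p, q) = (0, 1) ->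
    `|p * complex.Re (elem_factor x - 1) + q * complex.Im (elem_factor x - 1)|
    <= 2 * Normc.normc x ^+ 3.
  move=> pq.
  pose A y := 0 + - u * y + (u ^+ 2 - v ^+ 2) / 2 * y ^+ 2.
  pose B y := 0 + - v * y + (u * v) * y ^+ 2.
  pose g y := expR (A y) *
     ((p + (p * u + q * v) * y + 0 * y ^+ 2) * cos (B y)
      + (q + (q * u - p * v) * y + 0 * y ^+ 2) * sin (B y)).
  pose a3 := u ^+ 3 - 3 * u * v ^+ 2.
  pose b3 := 3 * u ^+ 2 * v - v ^+ 3.
  pose dg t := expR (A t) * t ^+ 2 *
    ((p * a3 + q * b3) * cos (B t) + (q * a3 - p * b3) * sin (B t)).
  have D t : is_derive t 1 g (dg t) by exact: is_derive_elem_factor.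
  have gcont : {within `[0, 1], continuous g}.
    by apply: derivable_within_continuous => t _; case: (D t).
  have gD t : t \in `]0, 1[ -> is_derive t 1 g (dg t) by move=> _; exact: D.
  have [t t01 gE] := MVT_segment ler01 gD gcont.
  rewrite subr0 mulr1 in gE.
  have -> : p * complex.Re (elem_factor x - 1) + q * complex.Im (elem_factor x - 1)
            = g 1 - g 0.
    rewrite /g /A /B /elem_factor /Cexp /cis.
    have -> : - x + x ^+ 2 / 2 =
        Complex (- u + (u ^+ 2 - v ^+ 2) / 2) (- v + u * v).
      rewrite /x expr2.
      have -> : (2 : R[i]) = (2 : R)%:C%C by rewrite rmorphMn.
      rewrite div_realC.
      by apply/eqP; rewrite eq_complex /=; apply/andP; split; apply/eqP; field.
    rewrite /= !(mulr0, expr0n, expr1n, mulr1, addr0, add0r, mul0r) /=.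
    by rewrite expR0 cos0 sin0; ring.
  rewrite gE; move: t01; rewrite in_itv /= => /andP[t0 t1].
  (* [W] is the derivative of [elem_factor (t x)] with respect to [t]. *)
  pose W : R[i] := (expR (A t) * t ^+ 2)%:C%C * (x ^+ 3 * cis (B t)).
  have -> : dg t = p * complex.Re W + q * complex.Im W.
    by rewrite /dg /a3 /b3 /W /x /cis 3!exprS expr0 /=; ring.
  have W1 : Normc.normc W <= 2 * Normc.normc x ^+ 3.
    rewrite /W Normc.normcM normc_real (Normc.normcM (x ^+ 3)) normc_cis.
    rewrite normcX mulr1.
    rewrite ler_wpM2r ?exprn_ge0 // ger0_norm ?mulr_ge0 ?expR_ge0 ?sqr_ge0 //.
    have hE : expR (A t) <= 2.
      have hA : A t <= 1 / 2.
        rewrite /A add0r; move: hu; rewrite ler_norml => /andP[hu1 hu2].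
        have : Normc.normc x ^+ 2 <= 1 / 16 by nra.
        by rewrite -hx2 => hh; nra.
      (* [exp (- 1 / 2) >= 1 - 1 / 2] *)
      have h1 : expR (1 / 2 : R) <= 2.
        have := expR_ge1Dx (- (1 / 2) : R); rewrite expRN => h.
        have h0 := expR_gt0 (1 / 2 : R).
        rewrite -[X in _ <= X]invrK -[X in X <= _]invrK.
        rewrite lef_pV2 ?posrE ?invr_gt0 //; lra.
      by apply: le_trans h1; rewrite ler_expR.
    have ht : t ^+ 2 <= 1 by rewrite expr_le1.
    have ht0 := sqr_ge0 t.
    by have := expR_ge0 (A t); nra.
  apply: le_trans W1.
  case: pq => [[-> ->]|[-> ->]]; rewrite mul0r mul1r ?addr0 ?add0r.
    exact: le_Re_normc.
  exact: le_Im_normc.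
have k1 := key 1 0 (or_introl erefl).
have k2 := key 0 1 (or_intror erefl).
rewrite mul0r mul1r addr0 in k1; rewrite mul0r mul1r add0r in k2.
apply: le_trans (normc_le_ReIm _) _.
by lra.
Qed.

Lemma ln_elem_factor_bound x : Normc.normc x <= 1 / 4 ->
  0 < Normc.normc (elem_factor x) /\
  `|ln (Normc.normc (elem_factor x))| <= 8 * Normc.normc x ^+ 3.
Proof.
move=> x4; have := elem_factor_bound x4.
have n0 := normc_ge0 x.
have : 4 * Normc.normc x ^+ 3 <= 1 / 2.
  have : Normc.normc x ^+ 3 <= (1 / 4) ^+ 3 by rewrite ler_pXn2r ?nnegrE.
  lra.
set y := 4 * _ => y2 hy.
have -> : 8 * Normc.normc x ^+ 3 = 2 * y by rewrite /y; ring.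
set m := Normc.normc (elem_factor x).
have efE : elem_factor x = 1 + (elem_factor x - 1) by rewrite addrC subrK.
have m1 : m <= 1 + y.
  rewrite /m efE.
  apply: le_trans (normc_triangle _ _) _.
  by rewrite Normc.normc1 lerD2l.
have m2 : 1 - y <= m.
  rewrite /m efE.
  apply: le_trans (normc_triangleB _ _).
  by rewrite Normc.normc1 lerD2l lerN2.
have y0 : 0 <= y by rewrite mulr_ge0 // exprn_ge0.
have m0 : 0 < m by lra.
split=> //; rewrite ler_norml; apply/andP; split.
- (* [- ln m = ln (1 / m) <= 1 / m - 1 <= 2 y] *)
  rewrite lerNl -lnV ?posrE //.
  have h := @le_ln1Dx R (m^-1 - 1).
  have mV : 0 < m^-1 by rewrite invr_gt0.
  rewrite (addrC 1) subrK in h.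
  apply: le_trans (h _) _; first by lra.
  have : m^-1 <= (1 - y)^-1 by rewrite lef_pV2 ?posrE //; lra.
  have : (1 - y)^-1 <= 1 + 2 * y.
    by rewrite -[X in X <= _]mul1r ler_pdivrMr; nra.
  lra.
- have h := @le_ln1Dx R (m - 1).
  rewrite (addrC 1) subrK in h.
  by apply: le_trans (h _) _; lra.
Qed.

End ElementaryFactor.

(** * Sums over squares of lattice points *)

Section SquareExhaustion.
Variables (T : Type) (idx : T) (op : Monoid.com_law idx).
Implicit Types (F : nat -> nat -> T) (j M : nat).

(** The big operation over the index set [{(k, l) <> (0, 0) : k, l < M}]. *)
Definition sqbig F M : T :=
  \big[op/idx]_(0 <= k < M)
     \big[op/idx]_(0 <= l < M | (k, l) != (0, 0)%N) F k l.

(** The big operation over the shell [max(k, l) = j]. *)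
Definition shellbig F j : T :=
  op (op (\big[op/idx]_(0 <= l < j) F j l) (\big[op/idx]_(0 <= k < j) F k j))
     (F j j).

Lemma sqbig1 F : sqbig F 1 = idx.
Proof. by rewrite /sqbig big_nat1 big_mkcond /= big_nat1 eqxx. Qed.

Lemma sqbig_recr F M : (0 < M)%N ->
  sqbig F M.+1 = op (sqbig F M) (shellbig F M).
Proof.
move=> M0; rewrite /sqbig big_nat_recr //=.
have -> : \big[op/idx]_(0 <= k < M)
     \big[op/idx]_(0 <= l < M.+1 | (k, l) != (0, 0)%N) F k l
   = op (sqbig F M) (\big[op/idx]_(0 <= k < M) F k M).
  rewrite /sqbig -big_split; apply: eq_bigr => k _.
  rewrite big_mkcond big_nat_recr //= -big_mkcond /=.
  by rewrite xpair_eqE (gtn_eqF M0) andbF.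
have -> : \big[op/idx]_(0 <= l < M.+1 | (M, l) != (0, 0)%N) F M l
   = op (\big[op/idx]_(0 <= l < M) F M l) (F M M).
  rewrite -big_nat_recr //; apply: eq_bigl => l.
  by rewrite xpair_eqE (gtn_eqF M0).
rewrite /shellbig !Monoid.mulmA; congr (op _ _).
exact: Monoid.mulmAC.
Qed.

End SquareExhaustion.

Arguments sqbig : simpl never.
Arguments shellbig : simpl never.

Local Notation sqsum F M := (sqbig (+%R : Monoid.com_law 0) F M).

Section RealSums.
Variable R : realType.
Implicit Types (u : nat -> R) (F : nat -> nat -> R) (c : R).

Local Notation shellsum F M := (shellbig (+%R : Monoid.com_law (0 : R)) F M).

Lemma ler_norm_sum_nat u c j : (forall k, (k < j)%N -> `|u k| <= c) ->
  `|\sum_(0 <= k < j) u k| <= j%:R * c.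
Proof.
move=> h; apply: le_trans (ler_norm_sum _ _ _) _.
have -> : j%:R * c = \sum_(0 <= k < j) c.
  by rewrite big_const_nat subn0 iter_addr addr0 mulr_natl.
by rewrite !big_mkord; apply: ler_sum => i _; exact: h.
Qed.

Lemma shellsum_bound F c j : (0 < j)%N ->
  (forall k l, maxn k l = j -> `|F k l| <= c) ->
  `|shellsum F j| <= 3 * j%:R * c.
Proof.
move=> j0 h.
have h1 : `|\sum_(0 <= l < j) F j l| <= j%:R * c.
  by apply: ler_norm_sum_nat => l lj; apply: h; apply/maxn_idPl/ltnW.
have h2 : `|\sum_(0 <= k < j) F k j| <= j%:R * c.
  by apply: ler_norm_sum_nat => k kj; apply: h; apply/maxn_idPr/ltnW.
have h3 : `|F j j| <= c by apply: h; rewrite maxnn.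
have c0 : 0 <= c by apply: le_trans h3.
have h4 : c <= j%:R * c by rewrite ler_peMl // ler1n.
rewrite /shellbig /=.
apply: le_trans (ler_normD _ _) _.
apply: le_trans (lerD (ler_normD _ _) (lexx _)) _.
lra.
Qed.

(** Terms of size [c / max(k, l)] have square sums of linear growth. *)
Lemma sqsum_bound F c K : (0 < K)%N -> 0 <= c ->
  (forall k l, (0 < maxn k l < K)%N -> `|F k l| <= c / (maxn k l)%:R) ->
  `|sqsum F K| <= 3 * c * K%:R.
Proof.
move=> K0 c0; elim: K K0 => // -[_ _ _|K IH _ h].
  by rewrite sqbig1 normr0 !mulr_ge0.
rewrite sqbig_recr //=.
apply: le_trans (ler_normD _ _) _.
rewrite -[K.+2%:R]natr1 mulrDr mulr1; apply: lerD.
  by apply: IH => // k l /andP[h1 h2]; apply: h; rewrite h1 ltnW.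
have K1 : 0 < K.+1%:R :> R by rewrite ltr0n.
have -> : 3 * c = 3 * K.+1%:R * (c / K.+1%:R).
  by field; rewrite lt0r_neq0.
apply: shellsum_bound => // k l kl.
by have := h k l; rewrite kl /= ltnSn; apply.
Qed.

(** Increments [c / k ^ 2] sum to at most [2 c / K] from [K] on; the induction keeps
    the sharper telescoping bound [2 c / K - 2 c / M]. *)
Lemma increments_bound u c K M : (0 < K <= M)%N -> 0 <= c ->
  (forall k, (K <= k)%N -> `|u k.+1 - u k| <= c / k%:R ^+ 2) ->
  `|u M - u K| <= 2 * c / K%:R.
Proof.
move=> /andP[K0 KM] c0 h.
have K0' : 0 < K%:R :> R by rewrite ltr0n.
suff : `|u M - u K| <= 2 * c / K%:R - 2 * c / M%:R.
  move=> /le_trans; apply; rewrite lerBlDr lerDl.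
  by rewrite divr_ge0 ?mulr_ge0.
elim: M KM => [|M IH]; first by rewrite leqNgt K0.
rewrite leq_eqVlt => /orP[/eqP <-|]; first by rewrite !subrr normr0.
rewrite ltnS => KM.
have M0 : (0 < M)%N by apply: leq_trans KM.
have M1 : 1 <= M%:R :> R by rewrite ler1n.
have -> : u M.+1 - u K = (u M.+1 - u M) + (u M - u K) by ring.
apply: le_trans (ler_normD _ _) _.
apply: le_trans (lerD (h _ KM) (IH KM)) _.
suff : c / M%:R ^+ 2 <= 2 * c / M%:R - 2 * c / M.+1%:R.
  set x1 := c / M%:R ^+ 2; set x2 := 2 * c / M%:R.
  by set x3 := 2 * c / M.+1%:R; set x4 := 2 * c / K%:R; lra.
rewrite -[M.+1%:R]natr1; move: M1; set t : R := M%:R; clearbody t => t1.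
have t0 : 0 < t by lra.
rewrite -subr_ge0.
have -> : 2 * c / t - 2 * c / (t + 1) - c / t ^+ 2
          = c * (t - 1) / (t ^+ 2 * (t + 1)).
  by field; rewrite !gt_eqF ?addr_gt0.
have t0' := ltW t0.
by rewrite divr_ge0 ?mulr_ge0 ?subr_ge0 ?exprn_ge0 ?addr_ge0.
Qed.

(** Terms of size [c / max(k, l) ^ 3] have square sums with tails [O(1 / K)]. *)
Lemma sqsum_tail_bound F c K M : (0 < K <= M)%N -> 0 <= c ->
  (forall k l, (K <= maxn k l)%N -> `|F k l| <= c / (maxn k l)%:R ^+ 3) ->
  `|sqsum F M - sqsum F K| <= 6 * c / K%:R.
Proof.
move=> /andP[K0 KM] c0 h.
have -> : 6 * c / K%:R = 2 * (3 * c) / K%:R by rewrite mulrA -natrM.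
apply: (@increments_bound (fun M => sqsum F M)); first by rewrite K0.
  by rewrite mulr_ge0.
move=> k Kk; have k0 : (0 < k)%N by apply: leq_trans Kk.
rewrite sqbig_recr //= addrAC subrr add0r.
have kR : 0 < k%:R :> R by rewrite ltr0n.
have -> : 3 * c / k%:R ^+ 2 = 3 * k%:R * (c / k%:R ^+ 3).
  by field; rewrite lt0r_neq0.
apply: shellsum_bound => // i j ij.
by have := h i j; rewrite ij; apply.
Qed.

(** Comparison of a sum of inverse squares along an arithmetic progression with
    the corresponding integral. *)
Lemma sum_inv_sq_arith (a d : R) n : 0 < a -> 0 < d ->
  `|\sum_(0 <= i < n) (a + d * i%:R) ^- 2 - d^-1 * (a^-1 - (a + d * n%:R)^-1)|
    <= a ^- 2.
Proof.
move=> a0 d0.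
suff /andP[h1 h2] : 0 <= \sum_(0 <= i < n) (a + d * i%:R) ^- 2
                        - d^-1 * (a^-1 - (a + d * n%:R)^-1)
                      <= a ^- 2 - (a + d * n%:R) ^- 2.
  rewrite ger0_norm //; apply: le_trans h2 _.
  by rewrite lerBlDr lerDl invr_ge0 sqr_ge0.
elim: n => [|n /andP[IH1 IH2]].
  by rewrite big_geq // mulr0 addr0 !subrr mulr0 subrr lexx.
have -> : a + d * n.+1%:R = a + d * n%:R + d.
  by rewrite -[n.+1%:R]natr1 mulrDr mulr1 addrA.
rewrite big_nat_recr //=.
move: IH1 IH2; set S := \sum_(0 <= i < n) _.
have : 0 < a + d * n%:R by rewrite ltr_wpDr // mulr_ge0 // ltW.
set x := a + d * n%:R; clearbody x S => x0 IH1 IH2.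
have xd : 0 < x + d by rewrite addr_gt0.
have e1 : x ^- 2 - d^-1 * (x^-1 - (x + d)^-1) = d / (x ^+ 2 * (x + d)).
  by field; rewrite !gt_eqF.
have e2 : x ^- 2 - (x + d) ^- 2 - (x ^- 2 - d^-1 * (x^-1 - (x + d)^-1))
   = x * d / (x ^+ 2 * (x + d) ^+ 2).
  by field; rewrite !gt_eqF.
have p1 : 0 <= d / (x ^+ 2 * (x + d)).
  by rewrite divr_ge0 ?mulr_ge0 ?exprn_ge0 ?ltW.
have p2 : 0 <= x * d / (x ^+ 2 * (x + d) ^+ 2).
  by rewrite divr_ge0 ?mulr_ge0 ?exprn_ge0 // ltW.
rewrite -e1 in p1; rewrite -e2 in p2.
move: p1 p2 IH1 IH2; rewrite !mulrBr.
by move=> p1 p2 IH1 IH2; apply/andP; split; lra.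
Qed.

Lemma ln_succ_bound (k : nat) : (0 < k)%N ->
  `|ln k.+1%:R - ln k%:R - k%:R^-1| <= (k%:R ^- 2 : R).
Proof.
move=> k0; have kR : 0 < k%:R :> R by rewrite ltr0n.
have kS : 0 < k.+1%:R :> R by rewrite ltr0n.
have u1 : ln (k.+1%:R) - ln k%:R <= (k%:R^-1 : R).
  rewrite -ln_div ?posrE //.
  have -> : k.+1%:R / k%:R = 1 + k%:R^-1 :> R.
    by rewrite -natr1; field; rewrite lt0r_neq0.
  by apply: le_ln1Dx; rewrite (lt_trans _ (_ : 0 < _)) ?invr_gt0 // ltrN10.
have u2 : k.+1%:R^-1 <= ln (k.+1%:R) - ln k%:R :> R.
  rewrite -[ln _ - ln _]opprB lerNr -ln_div ?posrE //.
  have -> : k%:R / k.+1%:R = 1 + - k.+1%:R^-1 :> R.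
    rewrite -[k.+1%:R in RHS]natr1 -natr1; field.
    by rewrite natr1 lt0r_neq0.
  apply: le_ln1Dx; rewrite ltrN2 invf_lt1 // ltr1n ltnS //.
rewrite ler_norml; apply/andP; split; last first.
  by apply: le_trans (_ : 0 <= _); rewrite ?subr_le0 // invr_ge0 sqr_ge0.
suff : k%:R^-1 - k.+1%:R^-1 <= (k%:R ^- 2 : R).
  move: u2; set x1 : R := k.+1%:R^-1; set x2 : R := k%:R ^- 2.
  by set x3 := ln _ - ln _; set x4 : R := k%:R^-1; lra.
rewrite -[k.+1%:R]natr1 -subr_ge0.
move: kR; set t : R := k%:R; clearbody t => t0.
have -> : t ^- 2 - (t^-1 - (t + 1)^-1) = (t ^+ 2 * (t + 1))^-1.
  by field; rewrite !gt_eqF ?addr_gt0.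
by rewrite invr_ge0 mulr_ge0 ?exprn_ge0 ?addr_ge0 // ltW.
Qed.

End RealSums.

Section LatticeSums.
Variables (R : realType) (tau : R).
Hypothesis tau_gt0 : 0 < tau.

(** The lattice point [k tau + l], as a real number. *)
Definition lattice_val (k l : nat) : R := k%:R * tau + l%:R.

Local Notation w := lattice_val.
Local Notation mu := (Num.min tau 1).

Lemma lattice_val_ge k l : mu * (maxn k l)%:R <= w k l.
Proof.
have h1 : mu <= tau by rewrite ge_min lexx.
have h2 : mu <= 1 by rewrite ge_min lexx orbT.
have k0 : 0 <= k%:R :> R by [].
have l0 : 0 <= l%:R :> R by [].
have h3 : mu * k%:R <= k%:R * tau by rewrite mulrC ler_wpM2l.
have h4 : mu * l%:R <= l%:R by rewrite ler_piMl.
have h5 : 0 <= k%:R * tau by rewrite mulr_ge0 // ltW.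
rewrite /lattice_val; case: (leqP k l) => _.
  by apply: le_trans h4 _; rewrite lerDr.
by apply: le_trans h3 _; rewrite lerDl.
Qed.

Lemma lattice_min_gt0 : 0 < mu.
Proof. by rewrite lt_min tau_gt0 ltr01. Qed.

Lemma lattice_val_gt0 k l : (0 < maxn k l)%N -> 0 < w k l.
Proof.
move=> h; apply: lt_le_trans (lattice_val_ge _ _).
by rewrite mulr_gt0 ?lattice_min_gt0 // ltr0n.
Qed.

(** The inverse squares of the lattice points sum to [ln K / tau + O(1)]: the
    shell [max(k, l) = j] contributes [1 / (tau j) + O(1 / j^2)]. *)
Lemma sqsum_inv_sq : exists C : R, 0 <= C /\ forall K, (0 < K)%N ->
  `|sqsum (fun k l => w k l ^- 2) K - tau^-1 * ln K%:R| <= C.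
Proof.
pose c := tau ^- 2 + 1 + (1 + tau) ^- 2 + tau^-1.
have tau1 : 0 < 1 + tau by rewrite addr_gt0.
have c0 : 0 <= c.
  by rewrite !addr_ge0 // invr_ge0 ?exprn_ge0 // ltW.
exists (2 * c); split; first by rewrite mulr_ge0.
move=> K K0.
pose u (K : nat) := sqsum (fun k l => w k l ^- 2) K - tau^-1 * ln K%:R.
have u1 : u 1%N = 0 by rewrite /u sqbig1 ln1 mulr0 subrr.
rewrite -/(u K) -[u K]subr0 -u1 -[2 * c]divr1.
apply: increments_bound => // k k0.
rewrite /u sqbig_recr //=.
set S := sqbig _ _ _.
have -> : S + shellbig +%R (fun k l => w k l ^- 2) k - tau^-1 * ln k.+1%:R
    - (S - tau^-1 * ln k%:R)
  = (shellbig +%R (fun k l => w k l ^- 2) k - (tau * k%:R)^-1)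
    - tau^-1 * (ln k.+1%:R - ln k%:R - k%:R^-1).
  by rewrite invfM; ring.
apply: le_trans (ler_normB _ _) _.
have kR : 0 < k%:R :> R by rewrite ltr0n.
have -> : c / k%:R ^+ 2 = ((tau * k%:R) ^- 2 + k%:R ^- 2
     + ((1 + tau) * k%:R) ^- 2) + tau^-1 * k%:R ^- 2.
  by rewrite /c; field; rewrite !gt_eqF.
apply: lerD; last first.
  rewrite normrM gtr0_norm ?invr_gt0 // ler_wpM2l ?invr_ge0 ?(ltW tau_gt0) //.
  exact: ln_succ_bound.
rewrite /shellbig /=.
have s1 := @sum_inv_sq_arith R (tau * k%:R) 1 k (mulr_gt0 tau_gt0 kR) ltr01.
have s2 := @sum_inv_sq_arith R k%:R tau k kR tau_gt0.
have e1 : \sum_(0 <= l < k) w k l ^- 2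
          = \sum_(0 <= l < k) (tau * k%:R + 1 * l%:R) ^- 2.
  by apply: eq_bigr => l _; rewrite /lattice_val mul1r [_ * tau]mulrC.
have e2 : \sum_(0 <= i < k) w i k ^- 2
          = \sum_(0 <= i < k) (k%:R + tau * i%:R) ^- 2.
  by apply: eq_bigr => i _; rewrite /lattice_val addrC [_ * tau]mulrC.
have e3 : w k k = (1 + tau) * k%:R by rewrite /lattice_val; ring.
rewrite e1 e2 e3; move: s1 s2.
set S1 := \sum_(0 <= l < k) _; set S2 := \sum_(0 <= l < k) _.
set m1 := _ * (_ - _); set m2 := _ * (_ - _).
move=> s1 s2.
have -> : S1 + S2 + ((1 + tau) * k%:R) ^- 2 - (tau * k%:R)^-1
        = (S1 - m1) + (S2 - m2) + ((1 + tau) * k%:R) ^- 2.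
  suff -> : (tau * k%:R)^-1 = m1 + m2 by ring.
  rewrite /m1 /m2; move: kR; set t : R := k%:R; clearbody t => kR.
  have -> : tau * t + 1 * t = (1 + tau) * t by ring.
  have -> : t + tau * t = (1 + tau) * t by ring.
  by field; rewrite !gt_eqF.
apply: le_trans (ler_normD _ _) _; apply: lerD.
  by apply: le_trans (ler_normD _ _) _; exact: lerD.
by rewrite ger0_norm // invr_ge0 sqr_ge0.
Qed.

End LatticeSums.

(** * The modulus of the Barnes product *)

Section BarnesProduct.
Variables (R : realType) (tau : R).
Hypothesis tau_gt0 : 0 < tau.
Implicit Types (z : R[i]) (k l j M : nat).

Local Notation w := (lattice_val tau).
Local Notation mu := (Num.min tau 1).
Local Notation T K := (sqsum (fun k l => w k l ^- 2) K).

Lemma barnes_factorE z k l :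
  barnes_factor tau z k l = elem_factor (z / (w k l)%:C%C).
Proof.
rewrite /barnes_factor /elem_factor /lattice_pt -/(w k l).
congr (_ * Cexp (_ + _)).
by rewrite expr_div_n invfM [2^-1 * _]mulrC mulrA.
Qed.

Lemma normc_div_lattice z k l : (0 < maxn k l)%N ->
  Normc.normc (z / (w k l)%:C%C) = Normc.normc z / w k l.
Proof.
move=> kl; rewrite div_realC Normc.normcM normc_real mulrC gtr0_norm //.
by rewrite invr_gt0 lattice_val_gt0.
Qed.

Lemma normc_div_lattice_le z k l : (0 < maxn k l)%N ->
  Normc.normc (z / (w k l)%:C%C) <= Normc.normc z / (mu * (maxn k l)%:R).
Proof.
move=> kl; rewrite normc_div_lattice // ler_wpM2l ?normc_ge0 //.
rewrite lef_pV2 ?posrE ?lattice_val_gt0 ?lattice_val_ge //.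
by rewrite mulr_gt0 ?lattice_min_gt0 // ltr0n.
Qed.

(** The logarithm of the modulus of a factor of the Barnes product. *)
Definition log_factor z k l : R := ln (Normc.normc (barnes_factor tau z k l)).

(** [|1 + x|] is bounded below in a cone around the imaginary axis, where
    [|Im x| >= delta |x|]. *)
Lemma normc_1D_ge (x : R[i]) (delta : R) : 0 < delta <= 1 ->
  delta * Normc.normc x <= `|complex.Im x| -> delta / 2 <= Normc.normc (1 + x).
Proof.
move=> /andP[d0 d1] h.
have h1 : Normc.normc x * delta <= Normc.normc (1 + x).
  rewrite mulrC; apply: le_trans h _.
  by have := le_Im_normc (1 + x); rewrite ImD /= add0r.
have h2 : 1 - Normc.normc x <= Normc.normc (1 + x).
  by rewrite -{1}(Normc.normc1 R); exact: normc_triangleB.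
have n0 := normc_ge0 x.
(* [h1] suffices when [|x| >= 1 / 2], [h2] when [|x| <= 1 / 2]. *)
nra.
Qed.

(** Inside the square of side [K >= |z|] a factor has modulus
    [exp (Re(z ^ 2) / (2 w ^ 2) + O(K / max(k, l)))]. *)
Lemma log_factor_inner (delta : R) : 0 < delta <= 1 ->
  exists c : R, 0 <= c /\ forall z K k l,
    delta * Normc.normc z <= `|complex.Im z| -> Normc.normc z <= K%:R ->
    (0 < maxn k l < K)%N ->
    0 < Normc.normc (barnes_factor tau z k l) /\
    `|log_factor z k l - complex.Re (z ^+ 2) / 2 * w k l ^- 2|
      <= c * K%:R / (maxn k l)%:R.
Proof.
move=> d01; have /andP[d0 d1] := d01.
pose D := - ln (delta / 2).
have D0 : 0 <= D by rewrite oppr_ge0 ln_le0 //; lra.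
have mu0 := lattice_min_gt0 tau_gt0.
exists (D + 2 / mu); split; first by rewrite addr_ge0 // divr_ge0 // ltW.
move=> z K k l hz zK /andP[kl0 klK].
have w0 := lattice_val_gt0 tau_gt0 kl0.
set x := z / (w k l)%:C%C.
have hx : delta * Normc.normc x <= `|complex.Im x|.
  rewrite /x normc_div_lattice // div_realC ImZ normrM gtr0_norm ?invr_gt0 //.
  by rewrite mulrA mulrC ler_wpM2l // invr_ge0 ltW.
have x1 := normc_1D_ge d01 hx.
have x0 : 0 < Normc.normc (1 + x) by apply: lt_le_trans x1; lra.
have xj : Normc.normc x <= K%:R / (mu * (maxn k l)%:R).
  apply: le_trans (normc_div_lattice_le z kl0) _.
  by rewrite ler_wpM2r // invr_ge0 mulr_ge0 // ltW.
rewrite /log_factor barnes_factorE -/x /elem_factor Normc.normcM normc_Cexp.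
split; first by rewrite mulr_gt0 // expR_gt0.
rewrite lnM ?posrE ?expR_gt0 // expRK ReD ReN.
have -> : complex.Re (x ^+ 2 / 2) = complex.Re (z ^+ 2) / 2 * w k l ^- 2.
  have -> : (2 : R[i]) = (2 : R)%:C%C by rewrite rmorphMn.
  rewrite div_realC ReZ /x div_realC exprMn -rmorphXn ReZ exprVn.
  ring.
rewrite addrA addrK.
have j0 : 0 < (maxn k l)%:R :> R by rewrite ltr0n.
have Kj : 1 <= K%:R / (maxn k l)%:R :> R.
  by rewrite ler_pdivlMr // mul1r ler_nat ltnW.
have -> : (D + 2 / mu) * K%:R / (maxn k l)%:R
        = D * (K%:R / (maxn k l)%:R) + 2 * (K%:R / (mu * (maxn k l)%:R)).
  by rewrite mulrDl mulrDl -!mulrA invfM; congr (_ + _); ring.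
have DK : D <= D * (K%:R / (maxn k l)%:R) by rewrite ler_peMr.
have n0 := normc_ge0 x.
have l1 : ln (Normc.normc (1 + x)) <= Normc.normc x.
  apply: (@le_trans _ _ (ln (1 + Normc.normc x))).
    rewrite ler_ln ?posrE //; last by rewrite ltr_wpDr.
    by have := normc_triangle 1 x; rewrite Normc.normc1.
  by apply: le_ln1Dx; apply: lt_le_trans n0; rewrite ltrN10.
have l2 : - D <= ln (Normc.normc (1 + x)).
  by rewrite /D opprK ler_ln ?posrE // divr_gt0.
have := le_Re_normc x; rewrite !ler_norml => /andP[r1 r2].
move: DK xj l1 l2 r1 r2 n0 D0; clear.
set X := Normc.normc x; set a := ln _; set b := D * _; set e := K%:R / _.
by move=> *; apply/andP; split; lra.
Qed.

(** Outside the square of side [K >= 4 |z| / min(tau, 1)] one has [|z / w| <= 1 / 4], and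
    the bounds on the elementary factor apply. *)
Lemma log_factor_outer z K k l : 4 * Normc.normc z <= mu * K%:R ->
  (0 < K <= maxn k l)%N ->
  [/\ 0 < Normc.normc (barnes_factor tau z k l),
      Normc.normc (barnes_factor tau z k l - 1)
        <= 4 * (Normc.normc z / mu) ^+ 3 / (maxn k l)%:R ^+ 3 &
      `|log_factor z k l|
        <= 8 * (Normc.normc z / mu) ^+ 3 / (maxn k l)%:R ^+ 3].
Proof.
move=> zK /andP[K0 Kkl].
have kl0 : (0 < maxn k l)%N by apply: leq_trans Kkl.
have mu0 := lattice_min_gt0 tau_gt0.
have j0 : 0 < (maxn k l)%:R :> R by rewrite ltr0n.
set x := z / (w k l)%:C%C.
have xj := normc_div_lattice_le z kl0; rewrite -/x in xj.
have x4 : Normc.normc x <= 1 / 4.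
  apply: le_trans xj _; rewrite ler_pdivrMr ?mulr_gt0 //.
  have : mu * K%:R <= mu * (maxn k l)%:R by rewrite ler_pM2l // ler_nat.
  by lra.
have x3 : Normc.normc x ^+ 3
    <= (Normc.normc z / mu) ^+ 3 / (maxn k l)%:R ^+ 3.
  rewrite -expr_div_n -mulrA -invfM lerXn2r ?nnegrE ?normc_ge0 //.
  by rewrite divr_ge0 ?normc_ge0 // mulr_ge0 // ltW.
have [h1 h2] := ln_elem_factor_bound x4.
have h3 := elem_factor_bound x4.
rewrite /log_factor barnes_factorE -/x; split => //.
- by apply: le_trans h3 _; rewrite -mulrA ler_pM2l.
- by apply: le_trans h2 _; rewrite -mulrA ler_pM2l.
Qed.

Lemma sqsum_linear (F H : nat -> nat -> R) (c : R) M :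
  sqsum (fun k l => F k l - c * H k l) M = sqsum F M - c * sqsum H M.
Proof.
rewrite /sqbig mulr_sumr -sumrB; apply: eq_bigr => k _.
by rewrite mulr_sumr -sumrB.
Qed.

(** The modulus of a square partial product, on the logarithmic scale.  The side
    [K] of the inner square is comparable to [|z|]; every shell [j >= K] outside of
    it contributes [O(|z| ^ 3 / j ^ 2)]. *)
Lemma log_partial_prod (delta : R) : 0 < delta <= 1 ->
  exists C : R, 0 <= C /\ forall z, 1 <= Normc.normc z ->
    delta * Normc.normc z <= `|complex.Im z| ->
    exists K, [/\ (0 < K)%N, 4 * Normc.normc z <= mu * K%:R,
      (forall k l, (0 < maxn k l)%N ->
         0 < Normc.normc (barnes_factor tau z k l)) &
      (forall M, (K <= M)%N ->
        `|sqsum (log_factor z) M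
          - complex.Re (z ^+ 2) / (2 * tau) * ln (Normc.normc z)|
        <= C * Normc.normc z ^+ 2)].
Proof.
move=> d01.
have [c [c0 inner]] := log_factor_inner d01.
have [CT [CT0 hT]] := sqsum_inv_sq tau_gt0.
have mu0 := lattice_min_gt0 tau_gt0.
have mu1 : mu <= 1 by rewrite ge_min lexx orbT.
pose b := 4 / mu + 1.
have b0 : 0 <= b by rewrite addr_ge0 // divr_ge0 // ltW.
(* The summands come from the inner square, from [sqsum_inv_sq] together with
   [|ln K - ln |z|| <= b - 1], and from the shells outside the square. *)
exists (3 * c * b ^+ 2 + (CT / 2 + (2 * tau)^-1 * (b - 1)) + 48 / mu ^+ 3).
have bb0 : 0 <= b - 1 by rewrite /b addrK divr_ge0 // ltW.
split.
  have mu3 : 0 <= mu ^- 3 by rewrite invr_ge0 exprn_ge0 // ltW.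
  have t2 : 0 <= (2 * tau)^-1 by rewrite invr_ge0 mulr_ge0 // ltW.
  have b2 : 0 <= b ^+ 2 by rewrite exprn_ge0.
  have p1 := mulr_ge0 (mulr_ge0 (ler0n R 3) c0) b2.
  have p2 : 0 <= CT / 2 by rewrite divr_ge0.
  have p3 := mulr_ge0 t2 bb0.
  have p4 := mulr_ge0 (ler0n R 48) mu3.
  by rewrite addr_ge0 // addr_ge0 // addr_ge0.
move=> z z1 hz.
set r := Normc.normc z in z1 hz *.
have r0 : 0 < r by lra.
pose K := (Num.truncn (4 * r / mu)).+1.
have /andP[K1 K2] : (Num.truncn (4 * r / mu))%:R <= 4 * r / mu < K%:R.
  by apply: truncn_itv; rewrite divr_ge0 ?mulr_ge0 // ltW.
have muK : 4 * r <= mu * K%:R.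
  by move: K2; rewrite ltr_pdivrMr // => /ltW; rewrite [mu * _]mulrC.
have K0 : (0 < K)%N by [].
have KR0 : 0 < K%:R :> R by rewrite ltr0n.
have rK : r <= K%:R by nra.
have Kb : K%:R <= b * r.
  have -> : b * r = 4 * r / mu + r by rewrite /b mulrDl mul1r mulrAC.
  by rewrite -[K%:R]natr1; apply: lerD.
clear K1 K2; clearbody K; exists K; split => //.
  move=> k l kl0; have [kK|Kk] := ltnP (maxn k l) K.
    by have [|//] := inner z K k l hz rK; rewrite kl0.
  by have [|//] := @log_factor_outer z K k l muK; rewrite K0.
move=> M KM.
pose S M := sqsum (log_factor z) M; rewrite -/(S M).
set a := complex.Re (z ^+ 2).
have ar : `|a| <= r ^+ 2.
  by apply: le_trans (le_Re_normc _) _; rewrite normcX.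
have e1 : `|S K - a / 2 * T K| <= 3 * c * b ^+ 2 * r ^+ 2.
  rewrite /S -sqsum_linear.
  apply: (@le_trans _ _ (3 * (c * K%:R) * K%:R)).
    apply: sqsum_bound => //; first by rewrite mulr_ge0.
    by move=> k l kl; have [] := inner z K k l hz rK kl.
  have -> : 3 * (c * K%:R) * K%:R = 3 * c * K%:R ^+ 2 by ring.
  rewrite -[_ * b ^+ 2 * _]mulrA -exprMn ler_wpM2l ?mulr_ge0 //.
  by rewrite lerXn2r ?nnegrE ?mulr_ge0 // ltW.
have e2 : `|S M - S K| <= 48 / mu ^+ 3 * r ^+ 2.
  apply: (@le_trans _ _ (6 * (8 * (r / mu) ^+ 3) / K%:R)).
    apply: sqsum_tail_bound => //.
    - by rewrite K0.
    - by rewrite mulr_ge0 // exprn_ge0 // divr_ge0 // ltW.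
    - by move=> k l Kkl; have [|//] := @log_factor_outer z K k l muK; rewrite K0.
  rewrite ler_pdivrMr //.
  have -> : 6 * (8 * (r / mu) ^+ 3) = 48 / mu ^+ 3 * r ^+ 2 * r.
    by field; rewrite gt_eqF.
  rewrite ler_wpM2l // mulr_ge0 ?exprn_ge0 ?divr_ge0 ?exprn_ge0 // ltW //.
have e3 : `|ln K%:R - ln r| <= b - 1.
  have h1 : ln r <= ln K%:R by rewrite ler_ln ?posrE.
  rewrite ger0_norm ?subr_ge0 // -ln_div ?posrE //.
  have h2 : K%:R / r <= 1 + (b - 1).
    by rewrite addrC subrK ler_pdivrMr.
  apply: le_trans (le_ln1Dx _); last by apply: lt_le_trans bb0; rewrite ltrN10.
  rewrite ler_ln ?posrE ?divr_gt0 //.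
  by apply: lt_le_trans h2; rewrite divr_gt0.
have e4 : `|a / 2 * T K - a / (2 * tau) * ln r|
    <= (CT / 2 + (2 * tau)^-1 * (b - 1)) * r ^+ 2.
  have -> : a / 2 * T K - a / (2 * tau) * ln r
    = a * ((T K - tau^-1 * ln K%:R) / 2 + (2 * tau)^-1 * (ln K%:R - ln r)).
    by rewrite invfM; ring.
  rewrite normrM mulrC ler_pM //.
  apply: le_trans (ler_normD _ _) _; rewrite !normrM.
  have t2 : 0 < (2 * tau)^-1 by rewrite invr_gt0 mulr_gt0.
  rewrite (gtr0_norm t2) (gtr0_norm (_ : 0 < 2^-1)) //.
  apply: lerD; first by rewrite ler_wpM2r // hT.
  by rewrite ler_pM2l.
have -> : S M - a / (2 * tau) * ln r = (S K - a / 2 * T K)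
  + (a / 2 * T K - a / (2 * tau) * ln r) + (S M - S K) by ring.
apply: le_trans (ler_normD _ _) _.
apply: le_trans (lerD (ler_normD _ _) (lexx _)) _.
rewrite [leRHS](_ : _ = 3 * c * b ^+ 2 * r ^+ 2 +
  (CT / 2 + (2 * tau)^-1 * (b - 1)) * r ^+ 2 + 48 / mu ^+ 3 * r ^+ 2); last by ring.
by apply: lerD => //; apply: lerD.
Qed.

(** The square partial products of the Barnes product. *)
Definition partial_prod z M : R[i] :=
  \prod_(0 <= k < M) \prod_(0 <= l < M | (k, l) != (0, 0)%N)
     barnes_factor tau z k l.

Lemma normc_partial_prod z M :
  (forall k l, (0 < maxn k l)%N -> 0 < Normc.normc (barnes_factor tau z k l)) ->
  Normc.normc (partial_prod z M) = expR (sqsum (log_factor z) M).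
Proof.
move=> pos; rewrite /partial_prod /sqbig normc_prod expR_sum.
apply: eq_bigr => k _; rewrite normc_prod expR_sum.
apply: eq_bigr => l kl; rewrite /log_factor lnK // posrE pos //.
by rewrite leq_max !lt0n -negb_and -xpair_eqE.
Qed.

(** [|a - 1| <= e ^ y - 1]: a closeness to 1 under which the bounds [y] of the
    factors of a product add up. *)
Definition near_one (a : R[i]) (y : R) :=
  Normc.normc (a - 1) <= expR y - 1.

Lemma near_oneM (a b : R[i]) (y y' : R) :
  near_one a y -> near_one b y' -> near_one (a * b) (y + y').
Proof.
rewrite /near_one => ha hb.
have b1 : Normc.normc b <= expR y'.
  have -> : b = (b - 1) + 1 by rewrite subrK.
  apply: le_trans (normc_triangle _ _) _.
  by rewrite Normc.normc1 -lerBrDr.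
have -> : a * b - 1 = (a - 1) * b + (b - 1) by ring.
apply: le_trans (normc_triangle _ _) _.
rewrite Normc.normcM expRD.
have -> : expR y * expR y' - 1 = (expR y - 1) * expR y' + (expR y' - 1) by ring.
by apply: lerD => //; apply: ler_pM => //; exact: normc_ge0.
Qed.

Lemma near_one_shell (F : nat -> nat -> R[i]) (y : R) j : (0 < j)%N ->
  (forall k l, maxn k l = j -> Normc.normc (F k l - 1) <= y) ->
  near_one (shellbig *%R F j) (3 * j%:R * y).
Proof.
move=> j0 h.
have y0 : 0 <= y by apply: le_trans (h j j _); rewrite ?normc_ge0 ?maxnn.
have hF k l : maxn k l = j -> near_one (F k l) y.
  by move=> /h hkl; rewrite /near_one; apply: le_trans hkl _;
     rewrite lerBrDl expR_ge1Dx.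
have big G : (forall i, (i < j)%N -> near_one (G i) y) ->
    near_one (\prod_(0 <= i < j) G i) (\sum_(0 <= i < j) y).
  move=> hG; rewrite !big_mkord; apply: (big_ind2 near_one).
  - by rewrite /near_one subrr Normc.normc0 expR0 subrr.
  - by move=> *; exact: near_oneM.
  - by move=> i _; exact: hG.
apply: (@le_trans _ _ (expR (shellbig +%R (fun _ _ => y) j) - 1)).
  apply: near_oneM; last by apply: hF; rewrite maxnn.
  apply: near_oneM; apply: big => i ij; apply: hF.
    exact/maxn_idPl/ltnW.
  exact/maxn_idPr/ltnW.
rewrite lerD2r ler_expR; apply: le_trans (ler_norm _) _.
by apply: (@shellsum_bound R) => // *; rewrite ger0_norm.
Qed.

(** The successive quotients [B] of the partial products satisfy
    [|B - 1| <= exp (c / M ^ 2) - 1], so bounded partial products have summable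
    increments. *)
Lemma partial_prod_cvg z K (A : R) : (0 < K)%N ->
  4 * Normc.normc z <= mu * K%:R ->
  (forall M, (K <= M)%N -> Normc.normc (partial_prod z M) <= A) ->
  (fun M => Normc.normc (partial_prod z M - barnes_prod tau z)) @ \oo --> (0 : R).
Proof.
move=> K0 muK hA.
pose c := 12 * (Normc.normc z / mu) ^+ 3.
have mu0 := lattice_min_gt0 tau_gt0.
have c0 : 0 <= c.
  by rewrite mulr_ge0 // exprn_ge0 // divr_ge0 ?normc_ge0 // ltW.
have A0 : 0 <= A := le_trans (normc_ge0 _) (hA K (leqnn K)).
have [l hl] : exists l : R[i],
    (fun M => Normc.normc (partial_prod z M - l)) @ \oo --> (0 : R).
  apply: (@cvg_normc_of_increments _ _ (A * (c * expR c)) A K) => //.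
    exact: mulr_ge0 A0 (mulr_ge0 c0 (expR_ge0 c)).
  move=> M KM; have M0 : (0 < M)%N by apply: leq_trans KM.
  have MR : 1 <= M%:R :> R by rewrite ler1n.
  have -> : partial_prod z M.+1 = partial_prod z M *
      shellbig *%R (barnes_factor tau z) M.
    exact: (@sqbig_recr _ _ ( *%R : Monoid.com_law (1 : R[i]))).
  rewrite -[X in _ * _ - X]mulr1 -mulrBr Normc.normcM -mulrA.
  apply: ler_pM; [exact: normc_ge0|exact: normc_ge0|exact: hA|].
  have h : near_one (shellbig *%R (barnes_factor tau z) M) (c / M%:R ^+ 2).
    have -> : c / M%:R ^+ 2
        = 3 * M%:R * (4 * (Normc.normc z / mu) ^+ 3 / M%:R ^+ 3).
      by rewrite /c; field; rewrite !gt_eqF // ltr0n.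
    apply: near_one_shell => // k l kl.
    have := @log_factor_outer z K k l muK; rewrite kl K0.
    by move=> /(_ KM) [].
  apply: le_trans h _.
  set y := c / M%:R ^+ 2.
  have y0 : 0 <= y by rewrite divr_ge0 // exprn_ge0.
  have yc : y <= c by rewrite ler_pdivrMr ?exprn_gt0 ?ler_peMr ?exprn_ege1 // ltr0n.
  have -> : c * expR c / M%:R ^+ 2 = y * expR c by rewrite /y mulrAC.
  (* [e^y - 1 <= y e^y], from [1 - y <= e^(- y)] *)
  apply: (@le_trans _ _ (y * expR y)); last by rewrite ler_wpM2l // ler_expR.
  have h1 := expR_ge1Dx (- y).
  have h2 := expRxMexpNx_1 y.
  have h3 := expR_gt0 y.
  nra.
have -> : barnes_prod tau z = l by apply: lim_normc.
exact: hl.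
Qed.

(** The uniform two-sided bounds on the partial products hold for their limit. *)
Lemma log_barnes_prod (delta : R) : 0 < delta <= 1 ->
  exists C : R, 0 <= C /\ forall z, 1 <= Normc.normc z ->
    delta * Normc.normc z <= `|complex.Im z| ->
    0 < Normc.normc (barnes_prod tau z) /\
    `|ln (Normc.normc (barnes_prod tau z))
      - complex.Re (z ^+ 2) / (2 * tau) * ln (Normc.normc z)|
    <= C * Normc.normc z ^+ 2.
Proof.
move=> d01; have [C [C0 hC]] := log_partial_prod d01.
exists C; split => // z z1 hz.
have [K [K0 muK pos hK]] := hC z z1 hz.
set m := complex.Re (z ^+ 2) / (2 * tau) * ln (Normc.normc z) in hK *.
set e := C * Normc.normc z ^+ 2 in hK *.
have lo M : (K <= M)%N -> expR (m - e) <= Normc.normc (partial_prod z M).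
  move=> /hK; rewrite normc_partial_prod // ler_expR ler_norml => /andP[h _].
  by move: h; set x := sqbig _ _ _; lra.
have hi M : (K <= M)%N -> Normc.normc (partial_prod z M) <= expR (m + e).
  move=> /hK; rewrite normc_partial_prod // ler_expR ler_norml => /andP[_ h].
  by move: h; set x := sqbig _ _ _; lra.
have cv := partial_prod_cvg K0 muK hi.
set P := barnes_prod tau z in cv *.
have cvn : (fun M => Normc.normc (partial_prod z M)) @ \oo --> Normc.normc P.
  apply/cvgrPdist_le => d d0.
  have /cvgrPdist_le/(_ d d0) := cv; apply: filterS => M.
  rewrite sub0r normrN ger0_norm ?normc_ge0 // => h.
  apply: le_trans h; rewrite distrC ler_norml; apply/andP; split.
    rewrite lerNl opprB.
    have := normc_triangleB P (partial_prod z M - P).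
    have := normc_triangle (partial_prod z M) (P - partial_prod z M).
    rewrite addrC subrK -(normc_opp (P - _)) opprB.
    by move=> *; lra.
  have := normc_triangle P (partial_prod z M - P).
  by rewrite addrC subrK => *; lra.
have Plo : expR (m - e) <= Normc.normc P.
  by apply: cvgr_to_ge cvn _; exists K.
have Phi : Normc.normc P <= expR (m + e).
  by apply: cvgr_to_le cvn _; exists K.
have P0 : 0 < Normc.normc P by apply: lt_le_trans Plo; exact: expR_gt0.
split=> //.
have l1 : m - e <= ln (Normc.normc P).
  by rewrite -ler_expR lnK.
have l2 : ln (Normc.normc P) <= m + e.
  by rewrite -ler_expR lnK.
by rewrite ler_norml; apply/andP; split; lra.
Qed.

End BarnesProduct.

(** * Growth along rays *)

Section LogGrowth.
Variable R : realType.
Implicit Types (g h : R -> R[i]) (kappa : R).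

(** [|g r|] is [exp (kappa r ^ 2 ln r + O(r ^ 2))] as [r --> +oo]. *)
Definition log_growth kappa g : Prop :=
  exists C : R, \forall r \near +oo,
    0 < Normc.normc (g r) /\
    `|ln (Normc.normc (g r)) - kappa * (r ^+ 2 * ln r)| <= C * r ^+ 2.

Lemma log_growthM k1 k2 g h : log_growth k1 g -> log_growth k2 h ->
  log_growth (k1 + k2) (fun r => g r * h r).
Proof.
move=> [C1 h1] [C2 h2]; exists (C1 + C2).
near=> r.
have [p1 b1] : 0 < Normc.normc (g r) /\
    `|ln (Normc.normc (g r)) - k1 * (r ^+ 2 * ln r)| <= C1 * r ^+ 2.
  by near: r.
have [p2 b2] : 0 < Normc.normc (h r) /\
    `|ln (Normc.normc (h r)) - k2 * (r ^+ 2 * ln r)| <= C2 * r ^+ 2.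
  by near: r.
rewrite Normc.normcM; split; first by rewrite mulr_gt0.
rewrite lnM ?posrE // !mulrDl opprD addrACA.
by apply: le_trans (ler_normD _ _) _; apply: lerD.
Unshelve. all: by end_near.
Qed.

Lemma log_growthV kappa g : log_growth kappa g ->
  log_growth (- kappa) (fun r => (g r)^-1).
Proof.
move=> [C hg]; exists C; apply: filterS hg => r [p1 b1].
rewrite Normc.normcV invr_gt0; split => //.
by rewrite lnV ?posrE // mulNr -opprD normrN.
Qed.

Lemma log_growth1 : log_growth 0 (fun=> 1).
Proof.
exists 0; near=> r.
by rewrite Normc.normc1 ln1 mul0r subrr normr0 mul0r.
Unshelve. all: by end_near.
Qed.

Lemma log_growth_prod (I : Type) (s : seq I) (P : pred I)
    (G : I -> R -> R[i]) kappa :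
  (forall i, P i -> log_growth kappa (G i)) ->
  log_growth (\sum_(i <- s | P i) kappa) (fun r => \prod_(i <- s | P i) G i r).
Proof.
move=> hG; elim: s => [|i s IH].
  rewrite big_nil.
  have -> : (fun r => \prod_(i <- [::] | P i) G i r) = fun=> 1.
    by apply/funext => r; rewrite big_nil.
  exact: log_growth1.
rewrite big_cons.
have -> : (fun r => \prod_(j <- i :: s | P j) G j r) =
    (fun r => if P i then G i r * \prod_(j <- s | P j) G j r
              else \prod_(j <- s | P j) G j r).
  by apply/funext => r; rewrite big_cons.
by case: ifPn => // Pi; apply: log_growthM => //; exact: hG.
Qed.

Lemma log_growth_Cexp g (A : R) :
  (\forall r \near +oo, Normc.normc (g r) <= A * r ^+ 2) ->
  log_growth 0 (fun r => Cexp (g r)).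
Proof.
move=> hA; exists A; apply: filterS hA => r hr.
rewrite normc_Cexp expR_gt0; split => //.
by rewrite expRK mul0r subr0; apply: le_trans (le_Re_normc _) hr.
Qed.

(** A negative coefficient beats every [exp (C r ^ k)] with [k <= 2]: for large [r]
    the product is at most [exp (- r)]. *)
Lemma log_growth_cvg0 kappa g (C : R) (k : nat) : kappa < 0 -> (k <= 2)%N ->
  log_growth kappa g ->
  Normc.normc (g r) * expR (C * r ^+ k) @[r --> +oo] --> (0 : R).
Proof.
move=> kap k2 [C' hg].
apply: (@squeeze_cvgr _ _ _ _ (fun=> 0) (fun r => expR (- r))); last first.
- exact: cvgr_expR.
- exact: cvg_cst.
near=> r.
have r1 : 1 <= r by near: r; exact: (nbhs_pinfty_ge (num_real _)).
have r0 : 0 < r by lra.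
have [p b] : 0 < Normc.normc (g r) /\
    `|ln (Normc.normc (g r)) - kappa * (r ^+ 2 * ln r)| <= C' * r ^+ 2.
  by near: r.
have lr : (C' + `|C| + 1) / (- kappa) <= ln r.
  by rewrite -ler_expR lnK //; near: r; exact: (nbhs_pinfty_ge (num_real _)).
rewrite mulr_ge0 ?normc_ge0 ?expR_ge0 //=.
rewrite -(lnK p) -expRD ler_expR.
have r2 : 0 <= r ^+ 2 by rewrite exprn_ge0 // ltW.
have h1 : C * r ^+ k <= `|C| * r ^+ 2.
  apply: le_trans (ler_norm _) _; rewrite normrM ler_wpM2l //.
  rewrite ger0_norm; last by rewrite exprn_ge0 // ltW.
  by rewrite ler_weXn2l.
have h2 : r <= r ^+ 2 by rewrite -{1}[r]expr1 ler_weXn2l.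
have h3 : (C' + `|C| + 1 + kappa * ln r) * r ^+ 2 <= 0.
  rewrite mulr_le0_ge0 //; move: lr; rewrite ler_pdivrMr ?oppr_gt0 //; lra.
move: b; rewrite ler_norml => /andP[_ b].
have : (C' + `|C| + 1 + kappa * ln r) * r ^+ 2
  = C' * r ^+ 2 + `|C| * r ^+ 2 + r ^+ 2 + kappa * (r ^+ 2 * ln r) by ring.
lra.
Unshelve. all: by end_near.
Qed.

Lemma log_growth_Ncvg0 kappa g : 0 < kappa -> log_growth kappa g ->
  ~ (Normc.normc (g r) @[r --> +oo] --> (0 : R)).
Proof.
move=> kap [C hg] cv.
suff : 1 <= (0 : R) by rewrite ler10.
apply: cvgr_to_ge cv _; near=> r.
have r1 : 1 <= r by near: r; exact: (nbhs_pinfty_ge (num_real _)).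
have r0 : 0 < r by lra.
have [p b] : 0 < Normc.normc (g r) /\
    `|ln (Normc.normc (g r)) - kappa * (r ^+ 2 * ln r)| <= C * r ^+ 2.
  by near: r.
have lr : C / kappa <= ln r.
  by rewrite -ler_expR lnK //; near: r; exact: (nbhs_pinfty_ge (num_real _)).
rewrite -(lnK p) -expR0 ler_expR.
move: b; rewrite ler_norml => /andP[b _].
have r2 : 0 <= r ^+ 2 by rewrite exprn_ge0 // ltW.
have h3 : 0 <= (kappa * ln r - C) * r ^+ 2.
  rewrite mulr_ge0 //; move: lr; rewrite ler_pdivrMr //; lra.
have : (kappa * ln r - C) * r ^+ 2 = kappa * (r ^+ 2 * ln r) - C * r ^+ 2 by ring.
lra.
Unshelve. all: by end_near.
Qed.

(** With [kappa = 0] allowed, a factor [exp (C r ^ 2)] is needed to compensate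
    the error term. *)
Lemma log_growth_Ncvg0_sqr kappa g : 0 <= kappa -> log_growth kappa g ->
  exists C : R, ~ (Normc.normc (g r) * expR (C * r ^+ 2) @[r --> +oo] --> (0 : R)).
Proof.
move=> kap [C hg]; exists C => cv.
suff : 1 <= (0 : R) by rewrite ler10.
apply: cvgr_to_ge cv _; near=> r.
have r1 : 1 <= r by near: r; exact: (nbhs_pinfty_ge (num_real _)).
have [p b] : 0 < Normc.normc (g r) /\
    `|ln (Normc.normc (g r)) - kappa * (r ^+ 2 * ln r)| <= C * r ^+ 2.
  by near: r.
rewrite -(lnK p) -expRD -expR0 ler_expR.
move: b; rewrite ler_norml => /andP[b _].
have : 0 <= kappa * (r ^+ 2 * ln r).
  by rewrite !mulr_ge0 // ?ln_ge0 // exprn_ge0 //; lra.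
lra.
Unshelve. all: by end_near.
Qed.

End LogGrowth.

Section BarnesG.
Variables (R : realType) (tau : R).
Hypothesis tau_gt0 : 0 < tau.
Implicit Types (z c d : R[i]).

(** Stirling's leading term for [G(z; tau)]; the constants of the exponential
    factor only enter the error. *)
Lemma log_barnesG (delta : R) : 0 < delta <= 1 ->
  exists C : R, 0 <= C /\ forall z, 1 <= Normc.normc z ->
    delta * Normc.normc z <= `|complex.Im z| ->
    0 < Normc.normc (barnesG tau z) /\
    `|ln (Normc.normc (barnesG tau z))
      - complex.Re (z ^+ 2) / (2 * tau) * ln (Normc.normc z)|
    <= C * Normc.normc z ^+ 2.
Proof.
move=> d01; have [C [C0 hC]] := log_barnes_prod tau_gt0 d01.
set c := barnes_consts tau.
pose A1 := Normc.normc (c.1%:C%C / tau%:C%C).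
pose A2 := Normc.normc (c.2%:C%C / (2 * (tau ^+ 2)%:C%C)).
exists (A1 + A2 + 1 + `|ln tau| + C); split.
  by rewrite !addr_ge0 // normc_ge0.
move=> z z1 hz; have [p b] := hC z z1 hz.
set r := Normc.normc z in z1 hz b *.
have r0 : 0 < r by lra.
have ntau : Normc.normc (z / tau%:C%C) = r / tau.
  by rewrite Normc.normcM Normc.normcV normc_real gtr0_norm.
rewrite /barnesG /barnes_weierstrass -/c.
set X := c.1%:C%C * z / tau%:C%C + _.
rewrite Normc.normcM (Normc.normcM (z / _)) ntau normc_Cexp.
have X1 : `|complex.Re X| <= (A1 + A2) * r ^+ 2.
  apply: le_trans (le_Re_normc _) _.
  have -> : X = (c.1%:C%C / tau%:C%C) * z
              + (c.2%:C%C / (2 * (tau ^+ 2)%:C%C)) * z ^+ 2.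
    by rewrite /X [_ * z / _]mulrAC [_ * z ^+ 2 / _]mulrAC.
  apply: le_trans (normc_triangle _ _) _.
  rewrite [Normc.normc (_ * z)]Normc.normcM [Normc.normc (_ * z ^+ 2)]Normc.normcM.
  rewrite -/A1 -/A2 normcX -/r mulrDl lerD2r ler_wpM2l ?normc_ge0 //.
  by rewrite -{1}[r]expr1 ler_weXn2l.
have rt : 0 < r / tau by rewrite divr_gt0.
have rE : 0 < r / tau * expR (complex.Re X) by rewrite mulr_gt0 ?expR_gt0.
split; first by rewrite mulr_gt0.
rewrite lnM ?posrE // lnM ?posrE ?expR_gt0 // expRK ln_div ?posrE //.
set m := complex.Re (z ^+ 2) / _ * ln r in b *.
have r2 : 1 <= r ^+ 2 by rewrite exprn_ege1.
have l1 : `|ln r| <= r ^+ 2.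
  rewrite ger0_norm ?ln_ge0 //; apply: le_trans (ltW (ln_sublinear r0)) _.
  by rewrite -{1}[r]expr1 ler_weXn2l.
have l2 : `|ln tau| <= `|ln tau| * r ^+ 2 by rewrite ler_peMr.
rewrite [X in `|X|](_ : _ = complex.Re X + (ln r - ln tau)
   + (ln (Normc.normc (barnes_prod tau z)) - m)); last by ring.
apply: le_trans (ler_normD _ _) _.
apply: le_trans (lerD (ler_normD _ _) (lexx _)) _.
have l3 : `|ln r - ln tau| <= r ^+ 2 + `|ln tau| * r ^+ 2.
  by apply: le_trans (ler_normB _ _) _; apply: lerD.
rewrite [leRHS](_ : _ = (A1 + A2) * r ^+ 2 + (r ^+ 2 + `|ln tau| * r ^+ 2)
   + C * r ^+ 2); last by ring.
by apply: lerD => //; apply: lerD.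
Qed.

(** Replacing [z = c + r d] by [r d] changes [Re(z ^ 2)] by [O(r)] and [ln |z|] by
    [O(1)], hence the main term by [O(r ^ 2)]. *)
Lemma log_growth_barnesG_ray c d : Normc.normc d = 1 -> complex.Im d != 0 ->
  log_growth (complex.Re (d ^+ 2) / (2 * tau))
    (fun r => barnesG tau (c + r%:C%C * d)).
Proof.
move=> d1 dI.
set y := `|complex.Im d|.
have y0 : 0 < y by rewrite normr_gt0.
have y1 : y <= 1 by rewrite -d1; exact: le_Im_normc.
(* For large [r], [|Im z| >= r |Im d| / 2] and [|z| <= 2 r]. *)
have [|C [C0 hC]] := @log_barnesG (y / 4); first by apply/andP; split; lra.
set e := Normc.normc c.
have e0 : 0 <= e := normc_ge0 c.
exists (4 * C + (6 * e + 1) / (2 * tau)); near=> r.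
have r1 : 2 * e + 2 <= r by near: r; exact: (nbhs_pinfty_ge (num_real _)).
have r2 : 2 * e / y <= r by near: r; exact: (nbhs_pinfty_ge (num_real _)).
have r0 : 0 < r by lra.
set z := c + r%:C%C * d.
set s := Normc.normc z.
have nrd : Normc.normc (r%:C%C * d) = r.
  by rewrite Normc.normcM normc_real d1 mulr1 gtr0_norm.
have s1 : s <= r + e.
  by rewrite addrC -nrd; exact: normc_triangle.
have s2 : r - e <= s.
  by rewrite /s /z [c + _]addrC -{1}nrd; exact: normc_triangleB.
have z1 : 1 <= Normc.normc z by rewrite -/s; lra.
have hz : y / 4 * Normc.normc z <= `|complex.Im z|.
  rewrite -/s.
  have h1 : r * y - e <= `|complex.Im z|.
    have -> : r * y = `|complex.Im (r%:C%C * d)|.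
      by rewrite ImZ normrM gtr0_norm.
    have := le_Im_normc c; rewrite -/e => hc.
    rewrite /z ImD [complex.Im c + _]addrC.
    apply: le_trans (lerB_normD _ _); rewrite lerD2l lerN2 //.
  have h2 : 2 * e <= r * y by move: r2; rewrite ler_pdivrMr.
  have h3 : s <= 2 * r by lra.
  have : y * s <= y * (2 * r) by rewrite ler_pM2l.
  lra.
have [p b] := hC z z1 hz.
split=> //; rewrite -/s in b.
set a := complex.Re (z ^+ 2) in b.
set q := complex.Re (d ^+ 2).
have q1 : `|q| <= 1.
  by apply: le_trans (le_Re_normc _) _; rewrite normcX d1 expr1n.
have aq : `|a - r ^+ 2 * q| <= 3 * e * r.
  have -> : a - r ^+ 2 * q = complex.Re (c ^+ 2 + c * (r%:C%C * d) *+ 2).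
    rewrite /a /z sqrrD ReD exprMn -rmorphXn ReZ -/q addrK.
    by [].
  apply: le_trans (le_Re_normc _) _.
  apply: le_trans (normc_triangle _ _) _.
  rewrite mulr2n.
  apply: le_trans (lerD (lexx _) (normc_triangle _ _)) _.
  rewrite normcX (Normc.normcM c) nrd -/e.
  have : e * e <= e * r by rewrite ler_wpM2l //; lra.
  by rewrite expr2; lra.
have s0 : 0 < s by lra.
have ls0 : 0 <= ln s by rewrite ln_ge0.
have ls : `|ln s| <= 2 * r.
  by rewrite ger0_norm //; have := ln_sublinear s0; lra.
have lsr : `|ln s - ln r| <= 1.
  have hs : ln s - ln r <= 1.
    rewrite -ln_div ?posrE //.
    have : ln (s / r) <= s / r - 1.
      rewrite -{1}[s / r](addrNK 1) addrC; apply: le_ln1Dx.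
      by have := divr_gt0 s0 r0; lra.
    have : s / r <= 2 by rewrite ler_pdivrMr //; lra.
    lra.
  have hr : ln r - ln s <= 1.
    rewrite -ln_div ?posrE //.
    have : ln (r / s) <= r / s - 1.
      rewrite -{1}[r / s](addrNK 1) addrC; apply: le_ln1Dx.
      by have := divr_gt0 r0 s0; lra.
    have : r / s <= 2 by rewrite ler_pdivrMr //; lra.
    lra.
  by rewrite ler_norml; apply/andP; split; lra.
rewrite [X in `|X|](_ : _ = (ln (Normc.normc (barnesG tau z))
    - a / (2 * tau) * ln s)
  + (2 * tau)^-1 * ((a - r ^+ 2 * q) * ln s + r ^+ 2 * q * (ln s - ln r)));
  last by ring.
apply: le_trans (ler_normD _ _) _.
rewrite [leRHS](_ : _ = 4 * C * r ^+ 2 + (6 * e + 1) / (2 * tau) * r ^+ 2);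
  last by rewrite mulrDl.
apply: lerD.
  apply: le_trans b _; rewrite [4 * C]mulrC -mulrA ler_wpM2l //.
  have : s ^+ 2 <= (2 * r) ^+ 2 by rewrite lerXn2r ?nnegrE //; lra.
  by rewrite exprMn; lra.
have t0 : 0 < (2 * tau)^-1 by rewrite invr_gt0 mulr_gt0.
rewrite [leRHS](_ : _ = (2 * tau)^-1 * ((6 * e + 1) * r ^+ 2)); last by ring.
rewrite normrM gtr0_norm // ler_pM2l //.
apply: le_trans (ler_normD _ _) _.
rewrite [leRHS](_ : _ = 6 * e * r ^+ 2 + r ^+ 2); last by rewrite mulrDl mul1r.
apply: lerD.
  rewrite normrM.
  have -> : 6 * e * r ^+ 2 = (3 * e * r) * (2 * r) by ring.
  by apply: ler_pM.
rewrite !normrM ger0_norm ?sqr_ge0 // -mulrA ler_piMr ?sqr_ge0 //.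
by rewrite mulr_ile1.
Unshelve. all: by end_near.
Qed.

End BarnesG.

(** * Sectors and the quotient of double gamma functions *)

Section Sectors.
Variable R : realType.
Implicit Types (x theta c : R).

Lemma cosD2pi_int x (k : int) : cos (x + 2 * pi * k%:~R) = cos x.
Proof.
have natc (y : R) (j : nat) : cos (y + 2 * pi * j%:R) = cos y.
  have -> : y + 2 * pi * j%:R = y + (pi *+ 2) *+ j.
    by rewrite mulr_natr [2 * pi]mulr_natl.
  exact: (periodicn (@cosD2pi R)).
case: k => j; first exact: natc.
by rewrite NegzE mulrNz mulrN -[x in RHS](subrK (2 * pi * j.+1%:R)) natc.
Qed.

Lemma sector_cos_gt0 c theta : sector c theta -> 0 < cos (2 * theta - 2 * c).
Proof.
move=> [k]; set y := _ - _ - _ => hy.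
have -> : 2 * theta - 2 * c = 2 * y + 2 * pi * (2 * k)%:~R.
  by rewrite /y intrM; ring.
rewrite cosD2pi_int; apply: cos_gt0_pihalf.
by move: hy; rewrite ltr_norml => /andP[h1 h2]; apply/andP; split; lra.
Qed.

Lemma cos_gt0_lt_pihalf x : `|x| <= pi -> 0 < cos x -> `|x| < pi / 2.
Proof.
move=> xpi; rewrite -(cos_norm x); apply: contraTT; rewrite -!leNgt => h.
rewrite -[`|x|](subrK (pi / 2)) cosDpihalf oppr_le0 sin_ge0_pi //.
by have := pi_gt0 R; move=> *; apply/andP; split; lra.
Qed.

Lemma cos2_lt0_sectorP theta : `|theta| <= pi ->
  cos (2 * theta) < 0 <->
  (sector (pi / 2) `|` sector (- (pi / 2)))%classic theta.
Proof.
move=> hpi; have p0 := pi_gt0 R.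
have e1 : cos (2 * theta - 2 * (pi / 2)) = - cos (2 * theta).
  rewrite -cosDpi -[RHS](cosD2pi_int _ (-1)); congr cos.
  by rewrite mulrNz mulr1z; field.
have e2 : cos (2 * theta - 2 * - (pi / 2)) = - cos (2 * theta).
  by rewrite -cosDpi; congr cos; field.
move: hpi; rewrite ler_norml => /andP[t1 t2].
split=> [h|[|] /sector_cos_gt0]; last 2 first.
- by rewrite e1; lra.
- by rewrite e2; lra.
have [t0|t0] := leP 0 theta; [left|right]; exists 0; rewrite mulr0z mulr0 subr0.
  have := @cos_gt0_lt_pihalf (2 * theta - 2 * (pi / 2)).
  rewrite e1 ler_norml !ltr_norml => hh.
  have /andP[h1 h2] : - (pi / 2) < 2 * theta - 2 * (pi / 2) < pi / 2.
    by apply: hh; [apply/andP; split; lra|lra].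
  by apply/andP; split; lra.
have := @cos_gt0_lt_pihalf (2 * theta - 2 * - (pi / 2)).
rewrite e2 ler_norml !ltr_norml => hh.
have /andP[h1 h2] : - (pi / 2) < 2 * theta - 2 * - (pi / 2) < pi / 2.
  by apply: hh; [apply/andP; split; lra|lra].
by apply/andP; split; lra.
Qed.

Lemma cos2_gt0_sectorP theta : `|theta| <= pi ->
  0 < cos (2 * theta) <-> (sector 0 `|` sector pi)%classic theta.
Proof.
move=> hpi; have p0 := pi_gt0 R.
have e (k : int) : cos (2 * theta - 2 * (pi * k%:~R)) = cos (2 * theta).
  rewrite -[RHS](cosD2pi_int _ (- k)); congr cos.
  by rewrite mulrNz; ring.
move: hpi; rewrite ler_norml => /andP[t1 t2].
split=> [h|[|] /sector_cos_gt0]; last 2 first.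
- by rewrite mulr0 subr0.
- by rewrite -(e 1) mulr1z mulr1.
have near (k : int) : `|theta - pi * k%:~R| <= pi / 2 ->
    `|theta - pi * k%:~R| < pi / 4.
  move=> hk; have := @cos_gt0_lt_pihalf (2 * theta - 2 * (pi * k%:~R)).
  rewrite e -mulrBr normrM ger0_norm // => hh.
  have : 2 * `|theta - pi * k%:~R| < pi / 2 by apply: hh => //; lra.
  lra.
have [u0|u0] := leP theta (- (pi / 2)).
  (* The direction [theta] is near [- pi], which is [pi] modulo [2 pi]. *)
  right; exists (-1).
  have := near (-1); rewrite !mulrNz !mulr1z !mulrN1 !opprK => nk.
  have -> : theta - pi + 2 * pi = theta + pi by ring.
  by apply: nk; rewrite ler_norml; apply/andP; split; lra.
have [v0|v0] := leP theta (pi / 2).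
  left; exists 0; have := near 0.
  rewrite !mulr0z !mulr0 !subr0; apply.
  by rewrite ler_norml; apply/andP; split; lra.
right; exists 0; have := near 1.
rewrite mulr0z mulr0 mulr1 subr0; apply.
by rewrite ler_norml; apply/andP; split; lra.
Qed.

End Sectors.

Section Phi.
Variables (R : realType) (tau : R) (p q m n : nat).
Variables (a : 'rV[R[i]]_p) (b : 'rV[R[i]]_q) (alpha : R[i]).
Hypotheses (tau_gt0 : 0 < tau) (le_mq : (m <= q)%N) (le_np : (n <= p)%N).

Lemma sum_ord_lt (k l : nat) (x : R) : (k <= l)%N ->
  \sum_(j < l | (j < k)%N) x = k%:R * x.
Proof.
move=> kl; rewrite -(big_ord_widen l (fun=> x) kl).
by rewrite sumr_const card_ord mulr_natl.
Qed.

Lemma sum_ord_ge (k l : nat) (x : R) : (k <= l)%N ->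
  \sum_(j < l | (k <= j)%N) x = (l%:R - k%:R) * x.
Proof.
move=> kl; have : \sum_(j < l) x = l%:R * x.
  by rewrite sumr_const card_ord mulr_natl.
rewrite (bigID (fun j : 'I_l => (j < k)%N)) /= sum_ord_lt // => h.
rewrite mulrBl -h addrC addrK; apply: eq_bigl => j.
by rewrite -leqNgt.
Qed.

Lemma Re_cis_sqr (theta : R) :
  complex.Re (cis theta ^+ 2) = cos (2 * theta).
Proof.
rewrite mulr_natl cos_mulr2n exprS expr1 /= -expr2 -[sin _ * _]expr2 sin2cos2.
by ring.
Qed.

Lemma log_growth_phi (z : log_surface R) (theta : R) : sin theta != 0 ->
  log_growth ((exponentN p q m n)%:~R * (cos (2 * theta) / (2 * tau)))
    (fun r => phi tau m n a b alpha (r%:C%C * cis theta)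
              * log_surface_powN z (r%:C%C * cis theta)).
Proof.
move=> st; set k0 := cos _ / _.
have ray_pos (c : R[i]) :
    log_growth k0 (fun r => barnesG tau (c + r%:C%C * cis theta)).
  rewrite /k0 -Re_cis_sqr.
  by apply: log_growth_barnesG_ray => //; exact: normc_cis.
have ray_neg (c : R[i]) :
    log_growth k0 (fun r => barnesG tau (c - r%:C%C * cis theta)).
  have -> : (fun r => barnesG tau (c - r%:C%C * cis theta))
          = (fun r => barnesG tau (c + r%:C%C * - cis theta)).
    by apply/funext => r; rewrite mulrN.
  rewrite /k0 -Re_cis_sqr -sqrrN.
  apply: log_growth_barnesG_ray => //; first by rewrite normc_opp normc_cis.
  by rewrite ImN oppr_eq0.
have g1 := log_growth_prod (index_enum 'I_q)
  (P := fun j => (j < m)%N) (fun j _ => ray_neg (b 0 j)).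
have g2 := log_growth_prod (index_enum 'I_p)
  (P := fun j => (j < n)%N) (fun j _ => ray_pos (1 + tau%:C%C - a 0 j)).
have g3 := log_growth_prod (index_enum 'I_q)
  (P := fun j => (m <= j)%N) (fun j _ => ray_pos (1 + tau%:C%C - b 0 j)).
have g4 := log_growth_prod (index_enum 'I_p)
  (P := fun j => (n <= j)%N) (fun j _ => ray_neg (a 0 j)).
rewrite sum_ord_lt // in g1; rewrite sum_ord_lt // in g2.
rewrite sum_ord_ge // in g3; rewrite sum_ord_ge // in g4.
have nrd (r : R) : 1 <= r -> Normc.normc (r%:C%C * cis theta) = r.
  move=> r1; rewrite Normc.normcM normc_real normc_cis mulr1 ger0_norm //.
  lra.
have g5 : log_growth 0 (fun r : R =>
    Cexp (pi%:C%C * alpha * (r%:C%C * cis theta) ^+ 2 / tau%:C%C)).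
  apply: (@log_growth_Cexp _ _ (Normc.normc (pi%:C%C * alpha / tau%:C%C))).
  near=> r.
  have r1 : 1 <= r by near: r; exact: (nbhs_pinfty_ge (num_real _)).
  by rewrite mulrAC Normc.normcM normcX nrd.
have g6 : log_growth 0
    (fun r : R => log_surface_powN z (r%:C%C * cis theta)).
  apply: (@log_growth_Cexp _ _ (Normc.normc (log_surface_log z))).
  near=> r.
  have r1 : 1 <= r by near: r; exact: (nbhs_pinfty_ge (num_real _)).
  rewrite Normc.normcM normc_opp nrd // mulrC ler_wpM2l ?normc_ge0 //.
  by rewrite -{1}[r]expr1 ler_weXn2l.
have := log_growthM (log_growthM (log_growthM (log_growthM g1 g2)
          (log_growthV (log_growthM g3 g4))) g5) g6.
rewrite [X in log_growth X](_ : _ = (exponentN p q m n)%:~R * k0) //.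
rewrite /exponentN !intrD !mulrNz intrM intrD !pmulrn.
by ring.
Unshelve. all: by end_near.
Qed.

End Phi.

Unset Implicit Arguments.

Theorem proposition3p2 (R : realType) (tau : R) (p q m n : nat)
    (a : 'rV[R[i]]_p) (b : 'rV[R[i]]_q) (alpha : R[i]) (z : log_surface R) (eps : R)
    (tau_gt0 : 0 < tau) (le_mq : (m <= q)%N) (le_np : (n <= p)%N)
    (eps_bound : 0 < eps < pi) (N_neq0 : exponentN p q m n != 0) :
  let N := exponentN p q m n in
  let f := fun s : R[i] => phi tau m n a b alpha s * log_surface_powN z s in
  [/\ (forall theta : R, eps <= `|theta| <= pi - eps ->
         superexp_decay f theta <-> N%:~R * cos (2 * theta) < 0),
      (forall theta : R, eps <= `|theta| <= pi - eps -> cos (2 * theta) != 0 ->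
         decays_beyond_exp 1 f theta <-> N%:~R * cos (2 * theta) < 0),
      (0 < N -> decay_directions eps f
                = admissible eps `&` (sector (pi / 2) `|` sector (- (pi / 2))))
    & (N < 0 -> decay_directions eps f
                = admissible eps `&` (sector 0 `|` sector pi))].
Proof.
move=> N f; have /andP[eps0 _] := eps_bound.
pose kappa theta : R := N%:~R * (cos (2 * theta) / (2 * tau)).
have kappaE theta : kappa theta = (N%:~R * cos (2 * theta)) / (2 * tau).
  by rewrite /kappa mulrA.
have t2 : 0 < (2 * tau)^-1 by rewrite invr_gt0 mulr_gt0.
have growth theta : eps <= `|theta| <= pi - eps ->
    log_growth (kappa theta) (fun r => f (r%:C%C * cis theta)).
  move=> /andP[h1 h2]; apply: log_growth_phi => //.
  have : 0 < sin `|theta| by apply: sin_gt0_pi; apply/andP; split; lra.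
  case: (ltrgt0P theta) => [_|_|-> ]; last by rewrite sin0 ltxx.
    by move=> /lt0r_neq0.
  by rewrite sinN => /lt0r_neq0; rewrite oppr_eq0.
have part1 theta : eps <= `|theta| <= pi - eps ->
    superexp_decay f theta <-> N%:~R * cos (2 * theta) < 0.
  move=> adm; have g := growth theta adm; split=> [dec|neg].
    rewrite ltNge; apply/negP => pos.
    have k0 : 0 <= kappa theta by rewrite kappaE mulr_ge0 // ltW.
    by have [C []] := log_growth_Ncvg0_sqr k0 g; exact: dec.
  move=> C; apply: log_growth_cvg0 g => //.
  by rewrite kappaE pmulr_llt0.
split=> //.
- move=> theta adm c0; have g := growth theta adm; split=> [dec|neg].
    rewrite ltNge le_eqVlt; apply/negP => /orP[/eqP e|pos].
      have /eqP := esym e; rewrite mulf_eq0 intr_eq0 (negbTE N_neq0) /=.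
      by rewrite (negbTE c0).
    have k0 : 0 < kappa theta by rewrite kappaE mulr_gt0.
    apply: (log_growth_Ncvg0 k0 g).
    have := dec 0; under eq_fun do rewrite mul0r expR0 mulr1.
    by [].
  move=> C; apply: log_growth_cvg0 g => //.
  by rewrite kappaE pmulr_llt0.
- move=> N0; apply/seteqP; split=> theta [adm].
    move=> /(part1 _ adm); rewrite pmulr_rlt0 ?ltr0z // => h; split=> //.
    apply/cos2_lt0_sectorP => //; case/andP: adm => _; lra.
  move=> h; split=> //; apply/(part1 _ adm); rewrite pmulr_rlt0 ?ltr0z //.
  by apply/cos2_lt0_sectorP => //; case/andP: adm => _; lra.
- move=> N0; apply/seteqP; split=> theta [adm].
    move=> /(part1 _ adm); rewrite nmulr_rlt0 ?ltrz0 // => h; split=> //.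
    apply/cos2_gt0_sectorP => //; case/andP: adm => _; lra.
  move=> h; split=> //; apply/(part1 _ adm); rewrite nmulr_rlt0 ?ltrz0 //.
  by apply/cos2_gt0_sectorP => //; case/andP: adm => _; lra.
Qed.
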